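(* Let $R$ be a noetherian ring of characteristic $p$. Then the following are equivalent: (1) $R$ is strongly $F$-regular. (2) For any multiplicatively closed subset $S$ of $R$, the localization $R_S$ is strongly $F$-regular. (3) $R_{\mathfrak m}$ is strongly $F$-regular for any maximal ideal $\mathfrak m$ of $R$. (4) For any maximal ideal $\mathfrak m$ of $R$, $\operatorname{Cl}_R(0,E_R(R/\mathfrak m))=0$. (5) For any maximal ideal $\mathfrak m$ of $R$, $\operatorname{Cl}_{R_{\mathfrak m}}(0,E_{R_{\mathfrak m}}(R/\mathfrak m))=0$. (6) $R_{\mathfrak m}$ is very strongly $F$-regular for any maximal ideal $\mathfrak m$ of $R$.
   Context: $p$ is a prime number; rings of characteristic $p$ are $\mathbb{F}_p$-algebras. $E_R(M)$ denotes the injective hull of the $R$-module $M$. For a ring $R$ of characteristic $p$ and $e\ge 0$, $R^{(-e)}$ denotes the ring $R$ viewed as an $R$-algebra via the $e$th Frobenius map $F^e:R\to R^{(-e)}$, $a\mapsto (a^{p^e})^{(-e)}$, where $r\in R$ viewed in $R^{(-e)}$ is written $r^{(-e)}$. $R^\circ := R\setminus\bigcup_{P\in\operatorname{Min} R}P$, where $\operatorname{Min} R$ is the set of minimal primes. For an $R$-module $M$ and a submodule $N\subset M$, the tight closure $\operatorname{Cl}_R(N,M)$ is the set of $x\in M$ for which there exist $c\in R^\circ$ and $e_0\ge 1$ such that for all $e\ge e_0$ the element $x\otimes c^{(-e)}\in M/N\otimes_R R^{(-e)}$ is zero. A noetherian ring $R$ of characteristic $p$ is strongly $F$-regular if $\operatorname{Cl}_R(N,M)=N$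 for every $R$-module $M$ and every submodule $N\subset M$. An $R$-linear map $M\to M'$ is $R$-pure if $W\otimes_R M\to W\otimes_R M'$ is injective for every $R$-module $W$. A noetherian ring $R$ of characteristic $p$ is very strongly $F$-regular if for any $c\in R^\circ$ there exists some $e>0$ such that the $R$-linear map $c^{(-e)}F^e: R\to R^{(-e)}$, $x\mapsto (cx^{p^e})^{(-e)}$, is $R$-pure. *)

(* Defs.v *)
From HB Require Import structures.
From mathcomp Require Import all_boot all_algebra ring.
From mathcomp Require Import boolp classical_sets.
From mathcomp.multinomials Require Import freeg.

Set Implicit Arguments.
Unset Strict Implicit.
Unset Printing Implicit Defensive.

Import GRing.Theory.
Local Open Scope classical_set_scope.
Local Open Scope ring_scope.
Local Open Scope quotient_scope.

(* Rings are [comPzRingType]s: the zero ring is allowed, since it occurs as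
   the localization at a multiplicative set containing 0.  An ideal of R is a
   submodule of the regular module, [submodClosed R^o]. *)

(* [pchar] is only defined for nonzero rings; this is the same definition.
   For prime p, it says that R is an F_p-algebra. *)
Definition pzchar (R : comPzRingType) : nat_pred :=
  [pred p | prime p & p%:R == 0 :> R].

Section Ideals.
Variable R : comPzRingType.
Implicit Types I P Q m : submodClosed R^o.

Definition noetherian : Prop := forall I, exists (n : nat) (g : 'I_n -> R),
  forall x : R, x \in I <-> exists a : 'I_n -> R, x = \sum_i a i * g i.

Lemma ideal0 I : (0 : R) \in I.
Proof. exact: rpred0. Qed.

Lemma idealD I (x y : R) : x \in I -> y \in I -> x + y \in I.
Proof. exact: rpredD. Qed.

Lemma idealMl I (a x : R) : x \in I -> a * x \in I.
Proof. exact: rpredZ. Qed.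

Definition prime_ideal P : Prop :=
  (1 : R) \notin P /\
  forall a b : R, a * b \in P -> (a \in P) || (b \in P).

Definition maximal_ideal m : Prop :=
  (1 : R) \notin m /\
  forall I, {subset m <= I} -> (1 : R) \notin I -> {subset I <= m}.

Definition minimal_prime P : Prop :=
  prime_ideal P /\
  forall Q, prime_ideal Q -> {subset Q <= P} -> {subset P <= Q}.

(* R° *)
Definition Rcirc : set R := [set c : R | forall P, minimal_prime P -> c \notin P].

Record maxIdeal := MaxIdeal {
  max_ideal :> submodClosed R^o;
  max_idealP : maximal_ideal max_ideal }.

End Ideals.

Section QuotientModule.
Variables (R : comPzRingType) (M : lmodType R) (N : submodClosed M).

(* A [submodClosed] is not canonically [zmodClosed]. *)
Definition sub_pred : {pred M} := fun x => x \in N.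

Lemma sub_pred_closed : zmod_closed sub_pred.
Proof.
split=> [|x y xN yN]; rewrite unfold_in ?rpred0 //.
by rewrite rpredD // -scaleN1r rpredZ.
Qed.

HB.instance Definition _ := GRing.isZmodClosed.Build M sub_pred sub_pred_closed.

Definition quotM : Type := {ideal_quot sub_pred}.
HB.instance Definition _ := GRing.Zmodule.on quotM.

Definition modcls (x : M) : quotM := \pi_{ideal_quot sub_pred} x.
Definition quotM_scale (a : R) (x : quotM) : quotM :=
  modcls (a *: repr (x : {ideal_quot sub_pred})).

Lemma modcls_eq x y : (modcls x == modcls y) = (x - y \in N).
Proof. by rewrite /modcls -Quotient.idealrBE. Qed.

Lemma modclsP (x : quotM) : exists y, x = modcls y.
Proof. by exists (repr (x : {ideal_quot sub_pred})); rewrite /modcls reprK. Qed.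

Lemma modclsD x y : modcls (x + y) = modcls x + modcls y.
Proof. exact: (raddfD (\pi_{ideal_quot sub_pred})). Qed.

Lemma quotM_scaleE a x : quotM_scale a (modcls x) = modcls (a *: x).
Proof.
apply/eqP; rewrite modcls_eq -scalerBr rpredZ // -modcls_eq.
by rewrite /modcls reprK.
Qed.

Lemma quotM_scaleA a b x :
  quotM_scale a (quotM_scale b x) = quotM_scale (a * b) x.
Proof. by have [y ->] := modclsP x; rewrite !quotM_scaleE scalerA. Qed.

Lemma quotM_scale1 : left_id 1 quotM_scale.
Proof. by move=> x; have [y ->] := modclsP x; rewrite quotM_scaleE scale1r. Qed.

Lemma quotM_scaleDr : right_distributive quotM_scale +%R.
Proof.
move=> a x y; have [x' ->] := modclsP x; have [y' ->] := modclsP y.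
by rewrite -modclsD !quotM_scaleE scalerDr modclsD.
Qed.

Lemma quotM_scaleDl x : {morph quotM_scale^~ x : a b / a + b}.
Proof.
by move=> a b; have [y ->] := modclsP x; rewrite !quotM_scaleE scalerDl modclsD.
Qed.

HB.instance Definition _ := GRing.Zmodule_isLmodule.Build R quotM
  quotM_scaleA quotM_scale1 quotM_scaleDr quotM_scaleDl.

End QuotientModule.

Definition zero_sub (R : comPzRingType) (M : lmodType R) : {pred M} :=
  [pred x | x == 0].

Lemma zero_sub_closed (R : comPzRingType) (M : lmodType R) :
  submod_closed (@zero_sub R M).
Proof.
split; first by rewrite inE.
by move=> a x y; rewrite !inE => /eqP-> /eqP->; rewrite scaler0 addr0.
Qed.

HB.instance Definition _ (R : comPzRingType) (M : lmodType R) :=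
  GRing.isSubmodClosed.Build R M (@zero_sub R M) (@zero_sub_closed R M).

Arguments zero_sub {R} M.

(* The tensor product over R, as an abelian group: the free abelian group on
   M * N modulo the subgroup [tens_rel] generated by the bilinearity
   relations.  (Its R-module structure plays no role here.) *)
Section Tensor.
Variables (R : comPzRingType) (M N : lmodType R).

Inductive tens_rel : {freeg (M * N) / int} -> Prop :=
| tens_rel0 : tens_rel 0
| tens_relB u v : tens_rel u -> tens_rel v -> tens_rel (u - v)
| tens_relDl x x' y :
    tens_rel (<< (x + x', y) >> - << (x, y) >> - << (x', y) >>)
| tens_relDr x y y' :
    tens_rel (<< (x, y + y') >> - << (x, y) >> - << (x, y') >>)
| tens_relZ a x y : tens_rel (<< (a *: x, y) >> - << (x, a *: y) >>).

Definition tens_null : {pred {freeg (M * N) / int}} :=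
  [pred u | `[< tens_rel u >]].

Lemma tens_null_closed : zmod_closed tens_null.
Proof.
split; first by apply/asboolP; exact: tens_rel0.
by move=> u v /asboolP hu /asboolP hv; apply/asboolP/tens_relB.
Qed.

HB.instance Definition _ :=
  GRing.isZmodClosed.Build {freeg (M * N) / int} tens_null tens_null_closed.

Definition tensor : Type := {ideal_quot tens_null}.
HB.instance Definition _ := GRing.Zmodule.on tensor.

Definition tens_cls (u : {freeg (M * N) / int}) : tensor :=
  \pi_{ideal_quot tens_null} u.
Definition tens (x : M) (y : N) : tensor := tens_cls << (x, y) >>.

Lemma tens_clsB u v : tens_cls (u - v) = tens_cls u - tens_cls v.
Proof. exact: (raddfB (\pi_{ideal_quot tens_null})). Qed.

Lemma tens_cls0 : tens_cls 0 = 0.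
Proof. exact: (raddf0 (\pi_{ideal_quot tens_null})). Qed.

Lemma tens_cls_eq u v : tens_cls u = tens_cls v <-> tens_rel (u - v).
Proof.
split=> [/eqP|h]; last apply/eqP; rewrite -Quotient.idealrBE.
  by move/asboolP.
exact/asboolP.
Qed.

Lemma tensDl x x' y : tens (x + x') y = tens x y + tens x' y.
Proof.
have := tens_relDl x x' y; rewrite -[X in tens_rel X]subr0.
by move/tens_cls_eq/eqP; rewrite tens_cls0 !tens_clsB -addrA -opprD subr_eq0 => /eqP.
Qed.

Lemma tensDr x y y' : tens x (y + y') = tens x y + tens x y'.
Proof.
have := tens_relDr x y y'; rewrite -[X in tens_rel X]subr0.
by move/tens_cls_eq/eqP; rewrite tens_cls0 !tens_clsB -addrA -opprD subr_eq0 => /eqP.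
Qed.

Lemma tensZ a x y : tens (a *: x) y = tens x (a *: y).
Proof. exact/tens_cls_eq/tens_relZ. Qed.

End Tensor.

(* The map W ⊗ f : W ⊗ M -> W ⊗ M'; see [tens_mapE]. *)
Section TensorMap.
Variables (R : comPzRingType) (W M M' : lmodType R) (f : {linear M -> M'}).

Definition tens_pre (u : {freeg (W * M) / int}) : tensor W M' :=
  fglift (fun z : W * M => tens z.1 (f z.2) : zmodule (tensor W M')) u.

Definition tens_map (t : tensor W M) : tensor W M' :=
  tens_pre (repr (t : {ideal_quot @tens_null R W M})).

Lemma tens_preB : {morph tens_pre : u v / u - v}.
Proof. exact: (@lift_is_additive _ _ (zmodule (tensor W M'))). Qed.

Lemma tens_preU x y : tens_pre << (x, y) >> = tens x (f y).
Proof. by rewrite /tens_pre liftU scale1r. Qed.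

Lemma tens_pre_rel u : tens_rel u -> tens_pre u = 0.
Proof.
elim=> [|v w _ hv _ hw|x x' y|x y y'|a x y].
- by rewrite -(subrr 0) tens_preB subrr.
- by rewrite tens_preB hv hw subr0.
- by rewrite !tens_preB !tens_preU tensDl addrAC addrK subrr.
- by rewrite !tens_preB !tens_preU raddfD tensDr addrAC addrK subrr.
- by rewrite !tens_preB !tens_preU linearZ tensZ subrr.
Qed.

Lemma tens_map_cls u : tens_map (tens_cls u) = tens_pre u.
Proof.
apply/eqP; rewrite -subr_eq0 -tens_preB; apply/eqP/tens_pre_rel/tens_cls_eq.
by rewrite /tens_cls reprK.
Qed.

Lemma tens_mapE x y : tens_map (tens x y) = tens x (f y).
Proof. by rewrite tens_map_cls tens_preU. Qed.

Lemma tens_mapB : {morph tens_map : t u / t - u}.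
Proof.
move=> t u; have cK (v : tensor W M) : v = tens_cls (repr (v : {ideal_quot @tens_null R W M})).
  by rewrite /tens_cls reprK.
by rewrite [t in LHS]cK [u in LHS]cK -tens_clsB tens_map_cls tens_preB.
Qed.

End TensorMap.

Arguments tens_map {R} W {M M'} f t.

Definition pure (R : comPzRingType) (M M' : lmodType R) (f : {linear M -> M'})
    : Prop :=
  forall W : lmodType R, injective (tens_map W f).

(* R^{(-e)}: the ring R, with the R-module structure coming from F^e. *)
Definition frob (R : comPzRingType) (p : nat) (_ : p \in pzchar R) (e : nat)
  : Type := R.

Section Frobenius.
Variables (R : comPzRingType) (p : nat) (pR : p \in pzchar R).

Lemma pzFrobeniusD e (x y : R) :
  (x + y) ^+ (p ^ e) = x ^+ (p ^ e) + y ^+ (p ^ e).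
Proof.
have /andP[p_pr /eqP p0] := pR.
elim: e => [|e IH]; first by rewrite expn0 !expr1.
rewrite expnSr !exprM IH; move: (x ^+ _) (y ^+ _) => {IH}x {}y.
have p_gt0 := prime_gt0 p_pr.
rewrite exprDn -(prednK p_gt0) big_ord_recl big_ord_recr /= big1 => [|i _].
  by rewrite /bump leq0n add1n bin0 binn subn0 subnn !expr0 mulr1 mul1r add0r.
have /dvdnP[k ->] : (p %| 'C(p.-1.+1, bump 0 i))%N.
  by rewrite prednK // prime_dvd_bin //= /bump leq0n add1n -ltn_predRL ltn_ord.
by rewrite -mulr_natr natrM p0 !mulr0.
Qed.

Variable e : nat.
Local Notation Re := (frob pR e).

HB.instance Definition _ := GRing.ComPzRing.on Re.

Definition frob_scale (a : R) (x : Re) : Re := (a ^+ (p ^ e) : Re) * x.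

Lemma frob_scaleA a b x : frob_scale a (frob_scale b x) = frob_scale (a * b) x.
Proof. by rewrite /frob_scale mulrA exprMn. Qed.

Lemma frob_scale1 : left_id 1 frob_scale.
Proof. by move=> x; rewrite /frob_scale expr1n mul1r. Qed.

Lemma frob_scaleDr : right_distributive frob_scale +%R.
Proof. by move=> a x y; rewrite /frob_scale mulrDr. Qed.

Lemma frob_scaleDl x : {morph frob_scale^~ x : a b / a + b}.
Proof. by move=> a b; rewrite /frob_scale pzFrobeniusD mulrDl. Qed.

HB.instance Definition _ := GRing.Zmodule_isLmodule.Build R Re
  frob_scaleA frob_scale1 frob_scaleDr frob_scaleDl.

(* c^{(-e)} F^e *)
Definition cF (c : R) (x : R^o) : Re := c * x ^+ (p ^ e).

Lemma cF_linear c : linear (cF c).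
Proof.
move=> a x y; rewrite /cF pzFrobeniusD mulrDr exprMn; congr (_ + _).
by rewrite mulrCA.
Qed.

HB.instance Definition _ c := GRing.isLinear.Build R R^o Re *:%R (cF c)
  (cF_linear c).

End Frobenius.

Section StrongFRegularity.
Variables (p : nat) (R : comPzRingType) (pR : p \in pzchar R).

(* [tens (modcls N x) c] is x ⊗ c^{(-e)} in M/N ⊗ R^{(-e)}. *)
Definition tight_closure (M : lmodType R) (N : submodClosed M) : set M :=
  [set x : M | exists2 c : R, Rcirc c & exists2 e0 : nat, (1 <= e0)%N &
     forall e : nat, (e0 <= e)%N -> tens (modcls N x) (c : frob pR e) = 0].

Definition strongly_F_regular : Prop :=
  noetherian R /\
  forall (M : lmodType R) (N : submodClosed M),
    tight_closure N = [set x : M | x \in N].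

Definition very_strongly_F_regular : Prop :=
  noetherian R /\
  forall c : R, Rcirc c -> exists2 e : nat, (0 < e)%N & pure (cF pR e c).

End StrongFRegularity.

Section InjectiveHull.
Variable R : comPzRingType.

Definition injective_module (E : lmodType R) : Prop :=
  forall (A B : lmodType R) (f : {linear A -> B}) (g : {linear A -> E}),
    injective f -> exists h : {linear B -> E}, forall x, h (f x) = g x.

Definition essential (M E : lmodType R) (i : {linear M -> E}) : Prop :=
  injective i /\
  forall N : submodClosed E, (exists2 x : E, x \in N & x != 0) ->
    exists2 y : M, i y \in N & i y != 0.

(* E_R(M) is only determined up to isomorphism: a statement about it is to be
   read as a statement about every injective hull i : M -> E. *)
Definition injective_hull (M E : lmodType R) (i : {linear M -> E}) : Prop :=
  injective_module E /\ essential i.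

End InjectiveHull.

(* The localization R_S, as classes of pairs (a, s). *)
Section Localization.
Variables (R : comPzRingType) (S : mulrClosed R).

Definition fracS : Type := (R * {s : R | s \in S})%type.
HB.instance Definition _ := Choice.on fracS.

Definition loc_rel (x y : fracS) : bool :=
  `[< exists2 u : R, u \in S & u * (x.1 * val y.2 - y.1 * val x.2) = 0 >].

Lemma loc_rel_equiv : equiv_class_of loc_rel.
Proof.
split=> [x|x y|y x z].
- by apply/asboolP; exists 1; [exact: rpred1|rewrite subrr mulr0].
- by apply/asboolP/asboolP => -[u uS h]; exists u => //;
    rewrite -opprB mulrN h oppr0.
- move=> /asboolP[u uS hu] /asboolP[v vS hv]; apply/asboolP.
  exists (u * v * val y.2); first by rewrite !rpredM ?(valP y.2).
  have -> : u * v * val y.2 * (x.1 * val z.2 - z.1 * val x.2) =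
    v * val z.2 * (u * (x.1 * val y.2 - y.1 * val x.2)) +
    u * val x.2 * (v * (y.1 * val z.2 - z.1 * val y.2)).
    by ring.
  by rewrite hu hv !mulr0 addr0.
Qed.

Canonical loc_equiv := EquivRelPack loc_rel_equiv.
Canonical loc_encModRel := defaultEncModRel loc_rel.

Definition loc : Type := {eq_quot loc_rel}.
HB.instance Definition _ := Choice.on loc.

Implicit Types (a b c : R) (s t u : {s : R | s \in S}) (x y z : loc).

(* The fraction a / s. *)
Definition mkloc a s : loc := \pi_({eq_quot loc_rel}) (a, s).

Lemma mkloc_eq a s b t :
  mkloc a s = mkloc b t <->
  exists2 u : R, u \in S & u * (a * val t - b * val s) = 0.
Proof.
split=> [/eqmodP/asboolP //|h].
by apply/eqmodP/asboolP.
Qed.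

Lemma mkloc_eqW a s b t : a * val t = b * val s -> mkloc a s = mkloc b t.
Proof.
by move=> h; apply/mkloc_eq; exists 1; rewrite ?rpred1 // h subrr mulr0.
Qed.

Lemma mklocP x : exists a s, x = mkloc a s.
Proof.
exists (repr (x : {eq_quot loc_rel})).1, (repr (x : {eq_quot loc_rel})).2.
by rewrite /mkloc -surjective_pairing reprK.
Qed.

Definition den1 : {s : R | s \in S} := exist _ 1 (rpred1 S).
Definition denM s t : {s : R | s \in S} :=
  exist _ (val s * val t) (rpredM (valP s) (valP t)).

Definition loc_num x : R := (repr (x : {eq_quot loc_rel})).1.
Definition loc_den x : {s : R | s \in S} := (repr (x : {eq_quot loc_rel})).2.

Lemma loc_numden x : mkloc (loc_num x) (loc_den x) = x.
Proof. by rewrite /mkloc -surjective_pairing reprK. Qed.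

Definition loc_add x y : loc :=
  mkloc (loc_num x * val (loc_den y) + loc_num y * val (loc_den x))
        (denM (loc_den x) (loc_den y)).
Definition loc_opp x : loc := mkloc (- loc_num x) (loc_den x).
Definition loc_mul x y : loc :=
  mkloc (loc_num x * loc_num y) (denM (loc_den x) (loc_den y)).

Lemma loc_addE a s b t : loc_add (mkloc a s) (mkloc b t) =
  mkloc (a * val t + b * val s) (denM s t).
Proof.
have /mkloc_eq[u uS hu] := loc_numden (mkloc a s).
have /mkloc_eq[v vS hv] := loc_numden (mkloc b t).
rewrite /loc_add; move: (loc_num (mkloc a s)) (loc_den (mkloc a s)) hu.
move: (loc_num (mkloc b t)) (loc_den (mkloc b t)) hv.
move=> b' t' hv a' s' hu; apply/mkloc_eq; exists (u * v); first by rewrite rpredM.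
rewrite [LHS](_ : _ = v * val t * val t' * (u * (a' * val s - a * val s'))
  + u * val s * val s' * (v * (b' * val t - b * val t'))) /=; last by ring.
by rewrite hu hv !mulr0 addr0.
Qed.

Lemma loc_oppE a s : loc_opp (mkloc a s) = mkloc (- a) s.
Proof.
have /mkloc_eq[u uS hu] := loc_numden (mkloc a s).
rewrite /loc_opp; move: (loc_num _) (loc_den _) hu.
move=> a' s' hu; apply/mkloc_eq; exists u => //.
by rewrite !mulNr -opprD mulrN hu oppr0.
Qed.

Lemma loc_mulE a s b t :
  loc_mul (mkloc a s) (mkloc b t) = mkloc (a * b) (denM s t).
Proof.
have /mkloc_eq[u uS hu] := loc_numden (mkloc a s).
have /mkloc_eq[v vS hv] := loc_numden (mkloc b t).
rewrite /loc_mul; move: (loc_num (mkloc a s)) (loc_den (mkloc a s)) hu.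
move: (loc_num (mkloc b t)) (loc_den (mkloc b t)) hv.
move=> b' t' hv a' s' hu; apply/mkloc_eq; exists (u * v); first by rewrite rpredM.
rewrite [LHS](_ : _ = v * b' * val t * (u * (a' * val s - a * val s'))
  + u * a * val s' * (v * (b' * val t - b * val t'))) /=; last by ring.
by rewrite hu hv !mulr0 addr0.
Qed.

Lemma loc_addA : associative loc_add.
Proof.
move=> x y z; have [a [s ->]] := mklocP x; have [b [t ->]] := mklocP y.
have [c [u ->]] := mklocP z; rewrite !loc_addE; apply: mkloc_eqW => /=; ring.
Qed.

Lemma loc_addC : commutative loc_add.
Proof.
move=> x y; have [a [s ->]] := mklocP x; have [b [t ->]] := mklocP y.
rewrite !loc_addE; apply: mkloc_eqW => /=; ring.
Qed.

Lemma loc_add0 : left_id (mkloc 0 den1) loc_add.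
Proof.
move=> x; have [a [s ->]] := mklocP x.
rewrite !loc_addE; apply: mkloc_eqW => /=; ring.
Qed.

Lemma loc_addN : left_inverse (mkloc 0 den1) loc_opp loc_add.
Proof.
move=> x; have [a [s ->]] := mklocP x.
rewrite loc_oppE loc_addE; apply: mkloc_eqW => /=; ring.
Qed.

HB.instance Definition _ := GRing.isZmodule.Build loc
  loc_addA loc_addC loc_add0 loc_addN.

Lemma loc_mulA : associative loc_mul.
Proof.
move=> x y z; have [a [s ->]] := mklocP x; have [b [t ->]] := mklocP y.
have [c [u ->]] := mklocP z; rewrite !loc_mulE; apply: mkloc_eqW => /=; ring.
Qed.

Lemma loc_mulC : commutative loc_mul.
Proof.
move=> x y; have [a [s ->]] := mklocP x; have [b [t ->]] := mklocP y.
rewrite !loc_mulE; apply: mkloc_eqW => /=; ring.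
Qed.

Lemma loc_mul1 : left_id (mkloc 1 den1) loc_mul.
Proof.
move=> x; have [a [s ->]] := mklocP x.
rewrite !loc_mulE; apply: mkloc_eqW => /=; ring.
Qed.

Lemma loc_mulDl : left_distributive loc_mul loc_add.
Proof.
move=> x y z; have [a [s ->]] := mklocP x; have [b [t ->]] := mklocP y.
have [c [u ->]] := mklocP z; rewrite !(loc_addE, loc_mulE).
apply: mkloc_eqW => /=; ring.
Qed.

HB.instance Definition _ := GRing.Zmodule_isComPzRing.Build loc
  loc_mulA loc_mulC loc_mul1 loc_mulDl.

Definition to_loc (a : R) : loc := mkloc a den1.

Lemma to_loc_zmod : zmod_morphism to_loc.
Proof.
move=> a b; rewrite -[RHS]/(loc_add (mkloc a den1) (loc_opp (mkloc b den1))).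
by rewrite loc_oppE loc_addE; apply: mkloc_eqW => /=; ring.
Qed.

Lemma to_loc_monoid : monoid_morphism to_loc.
Proof.
split=> // a b; rewrite -[RHS]/(loc_mul (mkloc a den1) (mkloc b den1)).
by rewrite loc_mulE; apply: mkloc_eqW => /=; ring.
Qed.

HB.instance Definition _ := GRing.isZmodMorphism.Build R loc to_loc to_loc_zmod.
HB.instance Definition _ :=
  GRing.isMonoidMorphism.Build R loc to_loc to_loc_monoid.

Lemma pzchar_loc (p : nat) : p \in pzchar R -> p \in pzchar loc.
Proof.
case/andP=> p_pr /eqP p0; rewrite inE p_pr /=.
by rewrite -(rmorph_nat to_loc) p0 rmorph0.
Qed.

End Localization.

Arguments pzchar_loc {R} S {p}.

Section LocalizationAtMaximal.
Variables (R : comPzRingType) (m : maxIdeal R).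

(* The ideal m + sR. *)
Definition adjoin (s : R) : {pred R^o} :=
  [pred x : R^o | `[< exists t : R, (x : R) - s * t \in (m : submodClosed R^o) >]].

Lemma adjoin_closed s : submod_closed (adjoin s).
Proof.
split; first by apply/asboolP; exists 0; rewrite mulr0 subr0; exact: ideal0.
move=> a x y /asboolP[t xt] /asboolP[u yu]; apply/asboolP; exists (a * t + u).
have -> : (a *: x + y : R^o) - s * (a * t + u) =
    a * ((x : R) - s * t) + ((y : R) - s * u) by rewrite /GRing.scale /=; ring.
by apply: idealD => //; apply: idealMl.
Qed.

HB.instance Definition _ s :=
  GRing.isSubmodClosed.Build R R^o (adjoin s) (adjoin_closed s).

Definition compl : {pred R} := fun x : R => x \notin (m : submodClosed R^o).

Lemma maxP1 : (1 : R) \notin (m : submodClosed R^o).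
Proof. by case: (max_idealP m). Qed.

Lemma compl_inv (s : R) : s \in compl ->
  exists t : R, 1 - s * t \in (m : submodClosed R^o).
Proof.
move=> sm; have [_ mmax] := max_idealP m.
have [/asboolP//|n1] := boolP ((1 : R) \in adjoin s).
suff sI : s \in adjoin s.
  have := mmax (adjoin s); move/(_ _ n1 s sI) => h.
  exfalso; move/negP: sm; apply; apply: h => x xm.
  by apply/asboolP; exists 0; rewrite mulr0 subr0.
by apply/asboolP; exists 1; rewrite mulr1 subrr; exact: ideal0.
Qed.

Lemma compl_closed : GRing.mulr_closed compl.
Proof.
split=> [|a b ac bc]; first exact: maxP1.
apply/negP => abm; have [t at1] := compl_inv ac; move/negP: bc; apply.
have -> : b = b * (1 - a * t) + t * (a * b) by ring.
by apply: idealD; apply: idealMl.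
Qed.

HB.instance Definition _ := GRing.isMulClosed.Build R compl compl_closed.

Definition locm : comPzRingType := loc compl.

(* R/m as an R_m-module: by [residue_scaleE], (a / s) x is the unique y such
   that s y = a x. *)
Definition residue : Type := quotM m.
HB.instance Definition _ := GRing.Zmodule.on residue.

Definition compl_pinv (s : {s : R | s \in compl}) : R :=
  sval (cid (compl_inv (valP s))).

Lemma compl_pinvP (s : {s : R | s \in compl}) (x : quotM m) :
  (val s * compl_pinv s) *: x = x.
Proof.
have [y ->] := modclsP x; rewrite -[LHS]/(quotM_scale _ _) quotM_scaleE.
apply/eqP; rewrite modcls_eq /compl_pinv; case: cid => t /= ht.
set u := val s; have -> : (u * t) *: y - y = - (y : R) * (1 - u * t).
  by rewrite /GRing.scale /=; ring.
exact: idealMl.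
Qed.

Lemma compl_inj (s : {s : R | s \in compl}) (x y : quotM m) :
  val s *: x = val s *: y -> x = y.
Proof.
move=> h; rewrite -(compl_pinvP s x) -(compl_pinvP s y).
by rewrite mulrC -!scalerA h.
Qed.

Definition residue_scale (k : locm) (x : residue) : residue :=
  (compl_pinv (loc_den k) * loc_num k) *: (x : quotM m).

Lemma residue_scaleE a s (x : residue) :
  val s *: (residue_scale (mkloc a s) x : quotM m) = a *: (x : quotM m).
Proof.
have /mkloc_eq[u uS] := loc_numden (mkloc a s); rewrite /residue_scale.
move: (loc_num _) (loc_den _) => b t /eqP; rewrite mulrBr subr_eq0 => /eqP h.
apply: (@compl_inj t); rewrite !scalerA.
rewrite [X in X *: _](_ : _ = val t * compl_pinv t * (val s * b)); last by ring.
rewrite -scalerA compl_pinvP; apply: (@compl_inj (exist _ u uS)).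
by rewrite /= !scalerA (mulrC (val s)) h (mulrC a).
Qed.

Lemma residue_scaleU k a s (x y : residue) : k = mkloc a s ->
  val s *: (y : quotM m) = a *: (x : quotM m) -> residue_scale k x = y.
Proof.
by move=> -> h; apply: (@compl_inj s); rewrite residue_scaleE.
Qed.

Lemma residue_scaleA j k x :
  residue_scale j (residue_scale k x) = residue_scale (j * k) x.
Proof.
have [a [s ->]] := mklocP j; have [b [t ->]] := mklocP k.
apply/esym/(residue_scaleU (loc_mulE _ _ _ _)).
rewrite -[val (denM s t)]/(val s * val t) mulrC -!scalerA residue_scaleE.
by rewrite scalerA mulrC -scalerA residue_scaleE.
Qed.

Lemma residue_scale1 : left_id 1 residue_scale.
Proof. by move=> x; apply: (@residue_scaleU _ 1 (den1 compl)). Qed.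

Lemma residue_scaleDr : right_distributive residue_scale +%R.
Proof.
move=> k x y; have [a [s ks]] := mklocP k; apply: (residue_scaleU ks).
by rewrite ks (scalerDr (val s)) !residue_scaleE -scalerDr.
Qed.

Lemma residue_scaleDl x : {morph residue_scale^~ x : j k / j + k}.
Proof.
move=> j k; have [a [s ->]] := mklocP j; have [b [t ->]] := mklocP k.
apply/(residue_scaleU (loc_addE _ _ _ _)).
rewrite -[val (denM s t)]/(val s * val t) (scalerDr (val s * val t)) scalerDl.
rewrite [in X in X + _ = _](mulrC (val s)) -!scalerA !residue_scaleE !scalerA.
by rewrite (mulrC (val t)) (mulrC (val s)).
Qed.

HB.instance Definition _ := GRing.Zmodule_isLmodule.Build locm residue
  residue_scaleA residue_scale1 residue_scaleDr residue_scaleDl.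

End LocalizationAtMaximal.

(* Main.v *)
(* Let x <> 0 lie in the tight closure of 0 in M.  Pick m containing Ann x and
   map M to the hull E of R/m so that x goes to a socle generator z; hence
   everything is decided by the elements z ⊗ c^(-e).  R \ m acts bijectively on
   E, so E is also the hull of R/m over R_m, and tight closure of 0 in E is the
   same over R and R_m.  Over R_m, z ⊗ c^(-e) <> 0 for one e > 0 already makes
   c^(-e) F^e pure, since every nonzero w in W is sent to z by some map W -> E;
   conversely purity of c^(-e) F^e for one e gives it for all multiples of e.
   Passing from R_S back to R requires lifting elements of (R_S)° to R°: R is
   reduced, so R° is the set of nonzerodivisors, and a lift which is a
   nonzerodivisor exists by the ascending chain condition.  Injective hulls
   exist because R has characteristic p: Hom_Z(R, K) is an injective module
   containing K. *)
Require Import Defs.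
From HB Require Import structures.
From mathcomp Require Import all_boot all_algebra ring.
From mathcomp Require Import boolp classical_sets.
From mathcomp.multinomials Require Import freeg.

Import GRing.Theory.
Local Open Scope classical_set_scope.
Local Open Scope ring_scope.

Set Implicit Arguments.
Unset Strict Implicit.
Unset Printing Implicit Defensive.

(** * Zorn's lemma above a given set *)

Lemma zorn_above (T : Type) (P : set (set T)) (A0 : set T) : P A0 ->
  (forall F : set (set T), F A0 -> F `<=` P -> total_on F subset ->
     P (\bigcup_(X in F) X)) ->
  exists A, [/\ A0 `<=` A, P A & forall B, A `<=` B -> P B -> B `<=` A].
Proof.
move=> PA0 Pcup; have [|A [PA maxA]] := @Zorn_bigcup T (fun X => P (A0 `|` X)).
  (* Adding [A0] itself to the sets A0 ∪ X gives a chain through [A0] even when [F] is empty; hence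
     the hypothesis only concerns chains containing [A0]. *)
  move=> F FP Ftot; pose G := [set A0] `|` [set A0 `|` X | X in F].
  have -> : A0 `|` \bigcup_(X in F) X = \bigcup_(X in G) X.
    apply/seteqP; split=> [x [A0x|[X FX Xx]]|x [_ [->|[X FX <-]]]].
    - by exists A0 => //; left.
    - by exists (A0 `|` X); [right; exists X|right].
    - by left.
    - by case=> Xx; [left|right; exists X].
  apply: Pcup; first by left.
    by move=> _ [->//|[X FX <-]]; apply: FP.
  move=> _ _ [->|[X FX <-]] [->|[Y FY <-]]; first by left.
  - by left=> x A0x; left.
  - by right=> x A0x; left.
  by have [XY|YX] := Ftot _ _ FX FY; [left|right]; apply: setUS.
exists (A0 `|` A); split=> // B AB PB; have AB' : A `<=` B by move=> x Ax; apply: AB; right.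
have [BA|BA] := pselect (B `<=` A); first by move=> x /BA; right.
exfalso; apply: (maxA B); first by [].
by have -> : A0 `|` B = B by apply: setUidr => x A0x; apply: AB; left.
Qed.

Lemma chain2 (T : Type) (F : set (set T)) x y : total_on F subset ->
  (\bigcup_(X in F) X) x -> (\bigcup_(X in F) X) y ->
  exists X, [/\ F X, X x & X y].
Proof.
move=> Ftot [X FX Xx] [Y FY Yy]; have [XY|YX] := Ftot _ _ FX FY.
  by exists Y; split=> //; apply: XY.
by exists X; split=> //; apply: YX.
Qed.

Definition addmap_of (U V : zmodType) (f : U -> V) (h : zmod_morphism f) :
  {additive U -> V} := HB.pack f (GRing.isZmodMorphism.Build U V f h).

(** * Submodules, quotients and extension of linear maps *)

Section Submodules.
Variables (R : comPzRingType) (M : lmodType R).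

(** Zorn's lemma produces bare sets, so submodules are first handled as sets; [submod_of] turns them
    into [submodClosed] structures. *)
Definition is_submod (N : set M) : Prop :=
  N 0 /\ forall a x y, N x -> N y -> N (a *: x + y).

Definition set_pred (N : set M) : {pred M} := fun x => `[< N x >].

Lemma set_pred_closed N : is_submod N -> submod_closed (set_pred N).
Proof.
move=> [N0 NL]; split; first exact/asboolP.
by move=> a x y /asboolP Nx /asboolP Ny; apply/asboolP/NL.
Qed.

Definition submod_of N (h : is_submod N) : submodClosed M :=
  HB.pack (set_pred N)
    (GRing.isSubmodClosed.Build R M (set_pred N) (set_pred_closed h)).

Lemma in_submod_of N (h : is_submod N) x : x \in submod_of h <-> N x.
Proof. by split=> [/asboolP|Nx] //; apply/asboolP. Qed.

End Submodules.

Section Submodule_sets.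
Variables (R : comPzRingType) (M : lmodType R).
Implicit Type N : set M.

Lemma submodD N x y : is_submod N -> N x -> N y -> N (x + y).
Proof. by case=> _ NL Nx Ny; rewrite -[x]scale1r; apply: NL. Qed.

Lemma submodZ N a x : is_submod N -> N x -> N (a *: x).
Proof. by case=> N0 NL Nx; rewrite -[a *: x]addr0; apply: NL. Qed.

Lemma submod_in (N : submodClosed M) : is_submod [set x | x \in N].
Proof. by split=> [|a x y Nx Ny] /=; [exact: rpred0|rewrite rpredD ?rpredZ]. Qed.

Lemma submod_bigcup (F : set (set M)) N0 : F N0 ->
  (forall N, F N -> is_submod N) -> total_on F subset ->
  is_submod (\bigcup_(N in F) N).
Proof.
move=> FN0 Fsub Ftot; split; first by exists N0 => //; case: (Fsub _ FN0).
move=> a x y Fx Fy; have [X [FX Xx Xy]] := chain2 Ftot Fx Fy.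
by exists X => //; case: (Fsub _ FX) => _; apply.
Qed.

End Submodule_sets.

Section LinearMaps.
Variable R : comPzRingType.
Implicit Types A B E : lmodType R.

Definition mklin A B (f : A -> B) (h : linear f) : {linear A -> B} :=
  HB.pack f (GRing.isLinear.Build R A B *:%R f h).

Lemma ker_submod A B (f : {linear A -> B}) : is_submod [set x | f x = 0].
Proof.
split=> [|a x y /= fx fy] /=; first exact: linear0.
by rewrite linearP fx fy scaler0 addr0.
Qed.

Lemma lin_inj A B (f : {linear A -> B}) : (forall x, f x = 0 -> x = 0) -> injective f.
Proof.
by move=> h x y /eqP; rewrite -subr_eq0 -linearB => /eqP/h/eqP; rewrite subr_eq0 => /eqP.
Qed.

Lemma modcls_linear A (N : submodClosed A) : linear (@modcls R A N).
Proof. by move=> a x y; rewrite modclsD -quotM_scaleE. Qed.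

Definition quot_map A (N : submodClosed A) : {linear A -> quotM N} :=
  mklin (@modcls_linear A N).

Lemma modcls0 A (N : submodClosed A) x : modcls N x = 0 <-> x \in N.
Proof.
by rewrite -[X in X \in N]subr0 -modcls_eq -[0 in RHS](linear0 (quot_map N)); split=> /eqP.
Qed.

Lemma quot_lift A B (N : submodClosed A) (f : {linear A -> B}) :
  (forall x, x \in N -> f x = 0) ->
  exists g : {linear quotM N -> B}, forall x, g (modcls N x) = f x.
Proof.
move=> fN; pose g (x : quotM N) := f (repr (x : {ideal_quot (sub_pred N)})).
have gE x : g (modcls N x) = f x.
  apply/eqP; rewrite -subr_eq0 -linearB; apply/eqP/fN; rewrite -modcls_eq.
  by rewrite /modcls reprK.
have glin : linear g.
  move=> a x y; have [x' ->] := modclsP x; have [y' ->] := modclsP y.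
  by rewrite -[_ *: _]/(quotM_scale _ _) quotM_scaleE -modclsD !gE linearP.
by exists (mklin glin).
Qed.

(** Both maps factor through A / ker f, on which [f] becomes injective. *)
Lemma inj_ext A B E (f : {linear A -> B}) (g : {linear A -> E}) :
  injective_module E -> (forall x, f x = 0 -> g x = 0) ->
  exists h : {linear B -> E}, forall x, h (f x) = g x.
Proof.
move=> Einj fg; pose N := submod_of (ker_submod f).
have NE x : x \in N <-> f x = 0 by apply: in_submod_of.
have [f' f'E] : exists f' : {linear quotM N -> B}, forall x, f' (modcls N x) = f x.
  by apply: quot_lift => x /NE.
have [g' g'E] : exists g' : {linear quotM N -> E}, forall x, g' (modcls N x) = g x.
  by apply: quot_lift => x /NE/fg.
have [|h hE] := Einj _ _ f' g'.
  apply: lin_inj => x; have [y ->] := modclsP x; rewrite f'E => fy.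
  exact/modcls0/NE.
by exists h => x; rewrite -f'E hE g'E.
Qed.

Definition submodT A (N : submodClosed A) : Type := {x : A | x \in N}.
HB.instance Definition _ A (N : submodClosed A) :=
  [isSub of submodT N for @sval _ _].
HB.instance Definition _ A (N : submodClosed A) := [Choice of submodT N by <:].
HB.instance Definition _ A (N : submodClosed A) :=
  [SubChoice_isSubLmodule of submodT N by <:].

Definition submod_val A (N : submodClosed A) : {linear submodT N -> A} :=
  \val.

End LinearMaps.

(** * Universal property of the tensor product *)

Section TensorMaps.
Variables (R : comPzRingType) (M N : lmodType R).

(** The bilinear map extends to the free abelian group and kills [tens_rel], so its value on
    representatives is well defined. Vanishing of tensors is later transported along such maps. *)
Lemma tensor_lift (A : zmodType) (g : M -> N -> A) :
  (forall x x' y, g (x + x') y = g x y + g x' y) ->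
  (forall x y y', g x (y + y') = g x y + g x y') ->
  (forall a x y, g (a *: x) y = g x (a *: y)) ->
  exists G : {additive tensor M N -> A}, forall x y, G (tens x y) = g x y.
Proof.
move=> gDl gDr gZ.
pose h (u : {freeg (M * N) / int}) : A :=
  fglift (fun z : M * N => g z.1 z.2 : zmodule A) u.
have hB : {morph h : u v / u - v} by exact: (@lift_is_additive _ _ (zmodule A)).
have hU x y : h << (x, y) >> = g x y by rewrite /h liftU scale1r.
have h_rel u : tens_rel u -> h u = 0.
  elim=> [|v w _ hv _ hw|x x' y|x y y'|a x y].
  - by have := hB 0 0; rewrite !subrr.
  - by rewrite hB hv hw subr0.
  - by rewrite !hB !hU gDl addrAC addrK subrr.
  - by rewrite !hB !hU gDr addrAC addrK subrr.
  - by rewrite !hB !hU gZ subrr.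
pose G (t : tensor M N) : A := h (repr (t : {ideal_quot @tens_null R M N})).
have Gcls u : G (tens_cls u) = h u.
  apply/eqP; rewrite -subr_eq0 -hB; apply/eqP/h_rel/tens_cls_eq.
  by rewrite /tens_cls reprK.
have GB : zmod_morphism G.
  have cK (v : tensor M N) :
      v = tens_cls (repr (v : {ideal_quot @tens_null R M N})).
    by rewrite /tens_cls reprK.
  by move=> t u; rewrite [t in LHS]cK [u in LHS]cK -tens_clsB Gcls hB.
exists (addmap_of GB) => x y.
by rewrite /= Gcls hU.
Qed.

(** Closure under differences gives sums and opposites, hence all integer multiples of pure tensors,
    and these generate. *)
Lemma tensor_ind (P : tensor M N -> Prop) :
  P 0 -> (forall t u, P t -> P u -> P (t - u)) -> (forall x y, P (tens x y)) ->
  forall t, P t.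
Proof.
move=> P0 PB Pt t.
have PD t1 t2 : P t1 -> P t2 -> P (t1 + t2).
  by move=> h1 h2; rewrite -[t2]opprK -[- t2]sub0r; apply/PB => //; apply/PB.
have clsD u v : tens_cls (u + v) = tens_cls u + tens_cls v.
  by rewrite -[v in LHS]opprK -[- v]sub0r !tens_clsB tens_cls0 sub0r opprK.
have -> : t = tens_cls (repr (t : {ideal_quot @tens_null R M N})).
  by rewrite /tens_cls reprK.
elim/freeg_ind_dom0: (repr _) => [|k [x y] u _ _ IH]; first by rewrite tens_cls0.
rewrite clsD; apply/PD => //.
have Pn n : P (tens_cls << (n%:Z) *g (x, y) >>).
  elim: n => [|n IHn]; first by rewrite freegU0 tens_cls0.
  by rewrite -addn1 PoszD -freegUD clsD; apply/PD => //; apply: Pt.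
case: k => n; first exact: Pn.
rewrite NegzE -freegUN -[- _]sub0r tens_clsB tens_cls0; apply/PB => //; exact: Pn.
Qed.

Lemma tens0l (y : N) : tens (0 : M) y = 0.
Proof. by apply/(addrI (tens 0 y)); rewrite -tensDl !addr0. Qed.

Lemma tens0r (x : M) : tens x (0 : N) = 0.
Proof. by apply/(addrI (tens x 0)); rewrite -tensDr !addr0. Qed.

Lemma tens_lin_r (N' : lmodType R) (f : {linear N -> N'}) (x : M) y :
  tens x y = 0 -> tens x (f y) = 0.
Proof.
have [||| G GE] := @tensor_lift _ (fun x y => tens x (f y)).
- by move=> *; rewrite tensDl.
- by move=> *; rewrite linearD tensDr.
- by move=> *; rewrite tensZ linearZ.
by rewrite -GE => ->; rewrite raddf0.
Qed.

Lemma tens_lin_l (M' : lmodType R) (f : {linear M -> M'}) x (y : N) :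
  tens x y = 0 -> tens (f x) y = 0.
Proof.
have [||| G GE] := @tensor_lift _ (fun x y => tens (f x) y).
- by move=> *; rewrite linearD tensDl.
- by move=> *; rewrite tensDr.
- by move=> *; rewrite linearZ tensZ.
by rewrite -GE => ->; rewrite raddf0.
Qed.

End TensorMaps.

Lemma tens_map0 (R : comPzRingType) (W M M' : lmodType R) (f : {linear M -> M'}) :
  tens_map W f 0 = 0.
Proof. by have := tens_mapB (W := W) f 0 0; rewrite !subrr. Qed.

Section RegularTensor.
Variables (R : comPzRingType) (W : lmodType R).

(** With [tens_regular0] this is W ⊗ R = W: scalars move to the left factor, and w ⊗ a is sent back
    to a w. *)
Lemma tens_regular (t : tensor W R^o) : exists w, t = tens w (1 : R^o).
Proof.
elim/tensor_ind: t => [|_ _ [v ->] [w ->]|w a].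
- by exists 0; rewrite tens0l.
- by exists (v - w); apply/eqP; rewrite subr_eq -tensDl subrK.
- by exists (a *: w); rewrite tensZ /GRing.scale /= mulr1.
Qed.

Lemma tens_regular0 (w : W) : tens w (1 : R^o) = 0 -> w = 0.
Proof.
have [||| G GE] := @tensor_lift R W R^o W (fun w a => a *: w).
- by move=> *; rewrite scalerDr.
- by move=> *; rewrite scalerDl.
- by move=> a x y; rewrite scalerA mulrC.
by move=> w0; rewrite -[w]scale1r -GE w0 raddf0.
Qed.

End RegularTensor.

(** * Purity of c^(-e) F^e and iterated Frobenius *)

Section FrobeniusTensor.
Variables (p : nat) (R : comPzRingType) (pR : p \in pzchar R).

Lemma frob_scaleE e (a : R) (x : frob pR e) :
  a *: x = (a ^+ (p ^ e) * x : R).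
Proof. by []. Qed.

(** Under W ⊗ R = W the map induced by c^(-e) F^e is w ↦ w ⊗ c^(-e), so purity says that all these
    maps have zero kernel. *)
Lemma pure_cF e (c : R) : pure (cF pR e c) <->
  forall (W : lmodType R) (w : W), tens w (c : frob pR e) = 0 -> w = 0.
Proof.
split=> [cpure W w wc|h W t u].
  apply/tens_regular0/(cpure W); rewrite tens_mapE /= /cF expr1n mulr1 wc.
  by rewrite tens_map0.
move/eqP; rewrite -subr_eq0 -tens_mapB => tu; apply/eqP; rewrite -subr_eq0.
have [w wE] := tens_regular (t - u); move: tu; rewrite wE tens_mapE /= /cF.
by rewrite expr1n mulr1 => /eqP/h ->; rewrite tens0l.
Qed.

(** Multiplication by r in the ring R^(-e), whereas the module scalar [r *: x] multiplies by
    r^(p^e). *)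
Definition frob_mul e (r : R) (x : frob pR e) : frob pR e := (r : frob pR e) * x.

Lemma frob_mul_linear e r : linear (@frob_mul e r).
Proof.
move=> a x y; rewrite /frob_mul mulrDr; congr (_ + _).
by rewrite !frob_scaleE mulrCA.
Qed.

Definition frob_mulL e r : {linear frob pR e -> frob pR e} :=
  mklin (@frob_mul_linear e r).

Lemma tens_frob_mul e (W : lmodType R) (w : W) (r c : R) :
  tens w (c : frob pR e) = 0 -> tens w (r * c : frob pR e) = 0.
Proof. exact: (tens_lin_r (frob_mulL e r)). Qed.

Section FrobeniusModule.
Variables (e : nat) (W : lmodType R).

(* The action of R on W ⊗ R^(-e) through the second factor, i.e. the
   R^(-e)-module obtained by extending scalars. *)
Definition frobT : Type := tensor W (frob pR e).
HB.instance Definition _ := GRing.Zmodule.on frobT.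

Definition frobT_scale (r : R) (t : frobT) : frobT :=
  tens_map W (frob_mulL e r) t.

Lemma frobT_scaleE r w (c : frob pR e) :
  frobT_scale r (tens w c) = tens w ((r : frob pR e) * c).
Proof. exact: tens_mapE. Qed.

Lemma frobT_scale0 r : frobT_scale r 0 = 0.
Proof. exact: tens_map0. Qed.

Lemma frobT_scaleA a b x :
  frobT_scale a (frobT_scale b x) = frobT_scale (a * b) x.
Proof.
elim/tensor_ind: x => [|t u ht hu|w c]; first by rewrite !frobT_scale0.
  by rewrite /frobT_scale !tens_mapB; congr (_ - _).
by rewrite !frobT_scaleE mulrA.
Qed.

Lemma frobT_scale1 : left_id 1 frobT_scale.
Proof.
elim/tensor_ind => [|t u ht hu|w c]; first by rewrite !frobT_scale0.
  by rewrite /frobT_scale !tens_mapB; congr (_ - _).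
by rewrite !frobT_scaleE mul1r.
Qed.

Lemma frobT_scaleDr : right_distributive frobT_scale +%R.
Proof.
have sB a x y : frobT_scale a (x - y) = frobT_scale a x - frobT_scale a y.
  exact: tens_mapB.
by move=> a x y; rewrite -[y in LHS]opprK -[- y]sub0r !sB frobT_scale0 sub0r opprK.
Qed.

Lemma frobT_scaleDl x : {morph frobT_scale^~ x : a b / a + b}.
Proof.
move=> a b; elim/tensor_ind: x => [|t u ht hu|w c].
- by rewrite !frobT_scale0 addr0.
- have sB r x y : frobT_scale r (x - y) = frobT_scale r x - frobT_scale r y.
    exact: tens_mapB.
  by rewrite !sB ht hu opprD addrACA.
- by rewrite !frobT_scaleE mulrDl tensDr.
Qed.

HB.instance Definition _ := GRing.Zmodule_isLmodule.Build R frobT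
  frobT_scaleA frobT_scale1 frobT_scaleDr frobT_scaleDl.

(** Since F^(e+f) is F^e followed by F^f, scalars can be extended by e and then by f; w ⊗ c goes to
    (w ⊗ 1) ⊗ c. *)
Lemma tens_frobD f (w : W) (c : R) : tens w (c : frob pR (e + f)) = 0 ->
  tens (tens w (1 : frob pR e) : frobT) (c : frob pR f) = 0.
Proof.
have [||| G GE] := @tensor_lift R W (frob pR (e + f)) (tensor frobT (frob pR f))
  (fun w c => tens (tens w (1 : frob pR e) : frobT) (c : frob pR f)).
- by move=> x x' y; rewrite tensDl; apply: tensDl.
- by move=> x y y'; apply: tensDr.
- move=> a x y; rewrite tensZ frob_scaleE mulrC.
  have -> : tens x (1 * (a ^+ (p ^ e))  : frob pR e) =
     a ^+ (p ^ e) *: (tens x (1 : frob pR e) : frobT) :> frobT.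
    by rewrite -[RHS]/(frobT_scale _ _) frobT_scaleE mulrC.
  by rewrite tensZ; congr (tens _ _); rewrite !frob_scaleE -exprM -expnD.
by rewrite -GE => ->; rewrite raddf0.
Qed.

End FrobeniusModule.

(** Very strong F-regularity supplies a single exponent, while tight closure sees only large ones.
    The induction on [n] applies its hypothesis to the base change [frobT e W]. *)
Lemma pure_cF_mul c e n : (0 < n)%N -> pure (cF pR e c) -> pure (cF pR (n * e) c).
Proof.
move=> n_gt0 /pure_cF cp; apply/pure_cF; case: n n_gt0 => // n _.
elim: n => [|n IH] W w; first by rewrite mul1n; apply: cp.
(* The extra factor is c acting as a scalar on the second Frobenius copy; moved to the left it turns
   w ⊗ 1 into w ⊗ c, so the induction hypothesis yields w ⊗ c = 0. *)
rewrite mulSn => /(tens_frob_mul (c ^+ (p ^ (n.+1 * e)))).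
move=> /tens_frobD wc; apply: (cp W w); apply: (IH (frobT e W)).
have -> : tens w (c : frob pR e) = c *: (tens w (1 : frob pR e) : frobT e W).
  by rewrite -[RHS]/(frobT_scale _ _) frobT_scaleE mulr1.
  by rewrite tensZ.
Qed.

End FrobeniusTensor.

(** * Tight closure of zero *)

Section TightClosure.
Variables (p : nat) (R : comPzRingType) (pR : p \in pzchar R).

Definition tight0 (M : lmodType R) (x : M) : Prop :=
  exists2 c : R, Rcirc c & exists2 e0 : nat, (1 <= e0)%N &
    forall e : nat, (e0 <= e)%N -> tens x (c : frob pR e) = 0.

Lemma tight0_lin (M M' : lmodType R) (f : {linear M -> M'}) x :
  tight0 x -> tight0 (f x).
Proof.
move=> [c cR [e0 e01 xc]]; exists c => //; exists e0 => // e /xc.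
exact: tens_lin_l.
Qed.

Lemma tight_closure0 (M : lmodType R) :
  tight_closure pR (zero_sub M) = [set 0] <-> forall x : M, tight0 x -> x = 0.
Proof.
have [g gE] : exists g : {linear quotM (zero_sub M) -> M},
    forall x, g (modcls (zero_sub M) x) = x.
  have idlin : linear (idfun : M -> M) by [].
  by apply: (quot_lift (f := mklin idlin)) => x /eqP.
have tE x : tight_closure pR (zero_sub M) x <-> tight0 x.
  by split=> [/(tight0_lin g)|]; rewrite ?gE //; apply: (tight0_lin (quot_map _)).
split=> [h x /tE|h]; first by rewrite h.
apply/seteqP; split=> [x /tE/h -> //|_ ->]; apply/tE.
exists 1; first by move=> P [[P1 _] _].
by exists 1%N => // e _; rewrite tens0l.
Qed.

(** The tight closure of N in M is the preimage of the tight closure of 0 in M / N. *)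
Lemma strongly_F_regularP : strongly_F_regular pR <->
  noetherian R /\ forall (M : lmodType R) (x : M), tight0 x -> x = 0.
Proof.
split=> -[noethR h]; split=> // M.
  apply/tight_closure0; rewrite h; apply/seteqP; split=> x; rewrite /= inE.
    by move/eqP.
  by move=> ->.
move=> N; apply/seteqP; split=> [x /h/modcls0 //|x /modcls0 xN].
exists 1; first by move=> P [[P1 _] _].
by exists 1%N => // e _; rewrite xN tens0l.
Qed.

End TightClosure.

(** * Minimal primes, zerodivisors and the chain condition *)

Section Primes.
Variable R : comPzRingType.

Definition is_mulset (T : set R) : Prop :=
  T 1 /\ forall a b, T a -> T b -> T (a * b).

Lemma mulsetX T a n : is_mulset T -> T a -> T (a ^+ n).
Proof. by move=> [T1 TM] Ta; elim: n => // n IH; rewrite exprS; apply: TM. Qed.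

Lemma mulset_adjoin T a : is_mulset T ->
  is_mulset [set x | exists2 t, T t & exists n, x = t * a ^+ n].
Proof.
move=> [T1 TM]; split; first by exists 1 => //; exists 0%N; rewrite mul1r.
move=> _ _ [t Tt [k ->]] [u Tu [n ->]]; exists (t * u); first exact: TM.
by exists (k + n)%N; rewrite exprD mulrACA.
Qed.

(* The complement of a maximal multiplicative set avoiding 0 is a minimal
   prime. *)
Lemma minimal_prime_avoiding T : is_mulset T -> ~ T 0 ->
  exists2 P : submodClosed R^o, minimal_prime P & forall t, T t -> t \notin P.
Proof.
move=> Tmul T0; pose good (X : set R) := is_mulset X /\ ~ X 0.
have [//||X [TX [Xmul X0] Xmax]] := @zorn_above R good T.
  move=> F FT Fgood Ftot; split=> [|[X FX X0]]; last by have [_] := Fgood _ FX.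
  split; first by exists T => //; case: Tmul.
  move=> a b Fa Fb; have [X [FX Xa Xb]] := chain2 Ftot Fa Fb.
  by exists X => //; have [[_ XM] _] := Fgood _ FX; apply: XM.
have [X1 XM] := Xmul.
(* By maximality of [X], adjoining an element outside it must produce 0. *)
have nX a : ~ X a -> exists2 t, X t & exists n, t * a ^+ n = 0.
  move=> Xa; have [XB0|nB0] := pselect
      ([set x | exists2 t, X t & exists n, x = t * a ^+ n] 0).
    by case: XB0 => t Xt [n tan]; exists t => //; exists n.
  exfalso; apply: Xa; apply: (Xmax _ _ (conj (mulset_adjoin a Xmul) nB0)).
    by move=> t Xt; exists t => //; exists 0%N; rewrite mulr1.
  by exists 1 => //; exists 1%N; rewrite mul1r.
have Xn t n a : X t -> t * a ^+ n = 0 -> ~ X a.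
  by move=> Xt ta Xa; apply: X0; rewrite -ta; apply: XM => //; apply: mulsetX.
have Psub : @is_submod R R^o (~` X).
  split=> //= r x y /nX[t Xt [k tx]] /nX[u Xu [n uy]].
  apply: (@Xn (t * u) (k + n)%N); first exact: XM.
  (* Each term of the binomial expansion of exponent k + n is divisible by x^k or by y^n, hence
     killed by t u. *)
  rewrite exprDn big_distrr /= big1 // => i _; rewrite mulrnAr.
  have [ile|ni] := leqP i n.
    rewrite -addnBA // exprD [_ *: _]/(r * x) exprMn.
    have -> : t * u * (r ^+ k * x ^+ k * (r * x) ^+ (n - i) * y ^+ i) =
      u * r ^+ k * (r * x) ^+ (n - i) * y ^+ i * (t * x ^+ k) by ring.
    by rewrite tx mulr0 mul0rn.
  have -> : y ^+ i = y ^+ (i - n) * y ^+ n by rewrite -exprD subnK // ltnW.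
  set z := (r *: x) ^+ _.
  have -> : t * u * (z * (y ^+ (i - n) * y ^+ n)) =
    t * z * y ^+ (i - n) * (u * y ^+ n) by ring.
  by rewrite uy mulr0 mul0rn.
pose P := submod_of Psub.
have PE a : a \in P <-> ~ X a by apply: in_submod_of.
have nP a : a \notin P <-> X a.
  by split=> [/negP aP|Xa]; [apply: contrapT => /PE|apply/negP => /PE].
exists P; last by move=> t /TX/nP.
split; first (split; first exact/nP).
  move=> a b abP; apply/orP; apply: contrapT => /not_orP[/negP/nP Xa /negP/nP Xb].
  by move/PE: abP; apply; apply: XM.
move=> Q [Q1 Qprime] QP a /PE/nX[t Xt [n tan]].
(* Since t lies outside P, hence outside Q, the prime Q containing t a^n = 0 contains a. *)
have : t * a ^+ n \in Q by rewrite tan ideal0.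
case/Qprime/orP=> [/QP tP|]; first by move/PE: tP.
elim: n {tan} => [|n IH]; first by rewrite (negPf Q1).
by rewrite exprS => /Qprime/orP[].
Qed.

Definition reduced_ring : Prop := forall x : R, x * x = 0 -> x = 0.

Lemma reducedX (x : R) n : reduced_ring -> x ^+ n = 0 -> x = 0.
Proof.
move=> red; elim/ltn_ind: n => -[|[|n]] IH.
- by rewrite expr0 => x1; rewrite -[x]mul1r x1 mul0r.
- by rewrite expr1.
- move=> xn; apply: (IH n.+1) => //; apply: red; rewrite -exprD.
  by rewrite addnS -addSn exprD xn mul0r.
Qed.

Definition regular (c : R) : Prop := forall d, c * d = 0 -> d = 0.

(** If c d = 0 with d nonzero, reducedness keeps the powers of d away from 0, and a minimal prime
    avoiding them would contain c. *)
Lemma Rcirc_regular (c : R) : reduced_ring -> Rcirc c -> regular c.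
Proof.
move=> red cR d cd; apply: contrapT => d0.
have [||P minP PT] := @minimal_prime_avoiding [set x | exists n, x = d ^+ n].
- split; first by exists 0%N.
  by move=> _ _ [k ->] [n ->]; exists (k + n)%N; rewrite exprD.
- by case=> n /esym/(reducedX red).
have /negP := cR P minP; case: minP => -[_ Pprime] _; apply.
have : c * d \in P by rewrite cd ideal0.
by case/Pprime/orP => // dP; have /negP[] := PT d (ex_intro _ 1%N (esym (expr1 d))).
Qed.

(** If c were in a minimal prime P, the products t c^n with t outside P would avoid 0 by regularity;
    a prime avoiding them lies in P and misses c, against minimality. *)
Lemma regular_Rcirc (c : R) : regular c -> Rcirc c.
Proof.
move=> creg P [[P1 Pprime] Pmin]; apply/negP => cP.
have Pmul : is_mulset [set t : R | t \notin P].
  by split=> //= a b aP bP; apply/negP => /Pprime; rewrite (negPf aP) (negPf bP).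
have [|Q [Qprime Qmin] QT] := minimal_prime_avoiding (mulset_adjoin c Pmul).
  case=> t tP [n /esym tcn]; suff t0 : t = 0 by rewrite /= t0 ideal0 in tP.
  elim: n tcn => [|n IH]; first by rewrite mulr1.
  by rewrite exprS mulrCA => /creg.
have QP : {subset Q <= P}.
  move=> x xQ; apply: contrapT => /negP xP.
  suff /QT/negP : [set x | exists2 t, t \notin P & exists n, x = t * c ^+ n] x.
    by [].
  by exists x => //; exists 0%N; rewrite mulr1.
suff /QT/negP : [set x | exists2 t, t \notin P & exists n, x = t * c ^+ n] c.
  by apply; exact: (Pmin Q Qprime QP).
by exists 1 => //; exists 1%N; rewrite mul1r.
Qed.

Lemma Rcirc1 : Rcirc (1 : R).
Proof. by move=> P [[P1 _] _]. Qed.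

Lemma maxIdeal_ann (M : lmodType R) (x : M) : x <> 0 ->
  exists m : maxIdeal R, forall a, a *: x = 0 -> a \in max_ideal m.
Proof.
move=> x0; pose good (X : set R) := @is_submod R R^o X /\ ~ X 1.
have [||X [annX [Xsub X1] Xmax]] := @zorn_above R good [set a | a *: x = 0].
- split; last by rewrite /= scale1r.
  split=> [|a y z /= yx zx]; first by rewrite /= scale0r.
  by rewrite scalerDl zx addr0 -[a *: y]/(a * y) -scalerA yx scaler0.
- move=> F FA Fgood Ftot; split=> [|[X FX X1]]; last by have [_] := Fgood _ FX.
  by apply: (@submod_bigcup R R^o F _ FA) => // N /Fgood[].
have mE a : a \in submod_of Xsub <-> X a by apply: in_submod_of.
have mmax : maximal_ideal (submod_of Xsub).
  split; first by apply/negP => /mE.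
  move=> I XI I1 a aI; apply/mE; apply: (Xmax [set a | a \in I]) => //.
    by move=> y /mE/XI.
  by split; [exact: (@submod_in R R^o)|exact/negP].
by exists (MaxIdeal mmax) => a /annX/mE.
Qed.

End Primes.

(** The union of a chain of ideals is finitely generated and its generators lie in one member, which
    is then the union; so Zorn's lemma applies. *)
Lemma noetherian_max (R : comPzRingType) (F : set (set R)) A0 :
  noetherian R -> F A0 -> (forall A, F A -> @is_submod R R^o A) ->
  exists2 A, F A & forall B, F B -> A `<=` B -> B `<=` A.
Proof.
move=> noeth FA0 Fsub; have [//||A [_ FA Amax]] := @zorn_above R F A0.
  move=> G GA0 GF Gtot.
  have Usub : @is_submod R R^o (\bigcup_(X in G) X).
    by apply: (@submod_bigcup R R^o G _ GA0) => // N /GF/Fsub.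
  have [n [g gE]] := noeth (submod_of Usub).
  have UE x : x \in submod_of Usub <-> (\bigcup_(X in G) X) x.
    exact: in_submod_of.
  have gU i : (\bigcup_(X in G) X) (g i).
    apply/UE/gE; exists (fun j => (j == i)%:R).
    by rewrite (bigD1 i) //= eqxx mul1r big1 ?addr0 // => j /negPf->; rewrite mul0r.
  suff [X GX Xg] : exists2 X, G X & forall i, X (g i).
    have -> : \bigcup_(X in G) X = X; last exact: GF.
    apply/seteqP; split=> [x /UE/gE[a ->]|x Xx]; last by exists X.
    have Xs := Fsub _ (GF _ GX).
    apply: (big_ind X); [by case: Xs|by move=> *; apply: (submodD Xs)|].
    by move=> i _; apply: (submodZ (a i) Xs).
  elim: n g gU {gE} => [|n IH] g gU; first by exists A0 => // -[].
  have [X GX Xg] := IH (fun i => g (fintype.lift ord0 i)) (fun i => gU _).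
  have [Y GY Yg] := gU ord0; have [XY|YX] := Gtot _ _ GX GY.
    by exists Y => // i; case: (unliftP ord0 i) => [j|] ->; [apply: XY|].
  by exists X => // i; case: (unliftP ord0 i) => [j|] ->; [|apply: YX].
by exists A => // B FB AB; apply: Amax.
Qed.

(** * Localization, and the passage between R° and (R_S)° *)

Section LocalizationTheory.
Variables (R : comPzRingType) (S : mulrClosed R).
Local Notation RS := (loc S).
Implicit Types (a b : R) (s t : {s : R | s \in S}).

Lemma mkloc_mul a s b t : mkloc a s * mkloc b t = mkloc (a * b) (denM s t).
Proof. exact: loc_mulE. Qed.

Lemma mkloc_add a s b t :
  mkloc a s + mkloc b t = mkloc (a * val t + b * val s) (denM s t).
Proof. exact: loc_addE. Qed.

Lemma mkloc_frac a s : mkloc a s = mkloc 1 s * to_loc S a.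
Proof. by rewrite mkloc_mul; apply: mkloc_eqW => /=; ring. Qed.

Lemma mkloc_den a s : to_loc S (val s) * mkloc a s = to_loc S a.
Proof. by rewrite mkloc_mul; apply: mkloc_eqW => /=; ring. Qed.

Lemma mkloc_eq0 a s : mkloc a s = 0 <-> exists2 u, u \in S & u * a = 0.
Proof.
rewrite -[0]/(mkloc 0 (den1 S)); split=> [/mkloc_eq|] [u uS] /=.
  by rewrite mulr1 mul0r subr0; exists u.
by move=> ua; apply/mkloc_eq; exists u => //=; rewrite mulr1 mul0r subr0.
Qed.

Lemma reduced_loc : reduced_ring R -> reduced_ring RS.
Proof.
move=> red k; have [a [s ->]] := mklocP k; rewrite mkloc_mul => /mkloc_eq0[u uS uaa].
apply/mkloc_eq0; exists u => //; apply: red.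
by rewrite mulrACA -mulrA uaa mulr0.
Qed.

(** An ideal of R_S is generated by the images of generators of its contraction to R. *)
Lemma noetherian_loc : noetherian R -> noetherian RS.
Proof.
move=> noeth I; have Jsub : @is_submod R R^o [set a | to_loc S a \in I].
  split=> [|a x y /= xI yI] /=; first by rewrite rmorph0 ideal0.
  by rewrite [_ *: _]/(a * x) rmorphD rmorphM idealD ?idealMl.
have [n [g gE]] := noeth (submod_of Jsub).
have JE a : a \in submod_of Jsub <-> to_loc S a \in I by exact: (in_submod_of Jsub a).
exists n, (fun i => to_loc S (g i)) => x; split=> [|[a ->]].
  have [a [s ->]] := mklocP x => xI.
  have [c ac] : exists c : 'I_n -> R, a = \sum_i c i * g i.
    by apply/gE/JE; rewrite -(mkloc_den a s) idealMl.
  exists (fun i => mkloc 1 s * to_loc S (c i)).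
  rewrite mkloc_frac ac rmorph_sum big_distrr /=.
  by apply: eq_bigr => i _; rewrite rmorphM mulrA.
apply: (big_ind (fun x => x \in I)); [exact: ideal0|exact: idealD|].
move=> i _; apply: idealMl; apply/JE/gE; exists (fun j => (j == i)%:R).
by rewrite (bigD1 i) //= eqxx mul1r big1 ?addr0 // => j /negPf->; rewrite mul0r.
Qed.

(** A minimal prime P of R_S contracts to a minimal prime J of R: a prime Q inside J misses S and
    extends to a prime inside P, which is then P. *)
Lemma Rcirc_loc c : Rcirc c -> Rcirc (to_loc S c).
Proof.
move=> cR P [[P1 Pprime] Pmin]; apply/negP => cP.
have Jsub : @is_submod R R^o [set a | to_loc S a \in P].
  split=> [|a x y /= xI yI] /=; first by rewrite rmorph0 ideal0.
  by rewrite [_ *: _]/(a * x) rmorphD rmorphM idealD ?idealMl.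
pose J := submod_of Jsub.
have JE a : a \in J <-> to_loc S a \in P by exact: (in_submod_of Jsub a).
have SJ u : u \in S -> u \in J -> False.
  move=> uS /JE uP; move/negP: P1; apply.
  have <- : mkloc 1 (exist _ u uS) * to_loc S u = 1.
    by rewrite mkloc_mul; apply: mkloc_eqW => /=; ring.
  exact: idealMl.
suff /cR/negP : minimal_prime J by apply; apply/JE.
split; first split.
- by apply/negP => /JE; rewrite rmorph1; apply/negP.
- move=> a b /JE; rewrite rmorphM => /Pprime/orP[] /JE ->//.
  by rewrite orbT.
move=> Q [Q1 Qprime] QJ a /JE aP.
(* As Q is prime and misses S, whether a numerator lies in Q depends only on the fraction. *)
have QE b s b' s' : mkloc b s = mkloc b' s' -> b' \in Q -> b \in Q.
  move=> /mkloc_eq[u uS]; rewrite mulrBr => /eqP; rewrite subr_eq0 => /eqP h b'Q.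
  have : (u * val s') * b \in Q.
    by rewrite -mulrA [val s' * b]mulrC h mulrA -mulrC mulrA idealMl.
  case/Qprime/orP => // /QJ /SJ[].
  by rewrite rpredM // (valP s').
pose Q' : set RS := [set k | exists2 b : R, b \in Q & exists s, k = mkloc b s].
have Q'sub : @is_submod RS RS^o Q'.
  split; first by exists 0; [exact: ideal0|exists (den1 S)].
  move=> k _ _ [b bQ [s ->]] [b' b'Q [s' ->]]; have [r [t ->]] := mklocP k.
  rewrite -[_ *: _]/(mkloc r t * mkloc b s) mkloc_mul mkloc_add.
  exists (r * b * val s' + b' * val (denM t s)); last by eexists.
  by rewrite idealD // 1?mulrC ?idealMl.
have Q'E k : k \in submod_of Q'sub <-> Q' k by exact: (in_submod_of Q'sub k).
have /Q'E[b bQ [s /QE]] : to_loc S a \in submod_of Q'sub; last by apply.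
apply: Pmin => //; last first.
  move=> k /Q'E[b bQ [s ->]]; rewrite mkloc_frac idealMl //.
  exact/JE/QJ.
split; first by apply/negP => /Q'E[b bQ [s /QE /(_ bQ)]]; rewrite (negPf Q1).
move=> k l; have [b [s ->]] := mklocP k; have [d [t ->]] := mklocP l.
rewrite mkloc_mul => /Q'E[b' b'Q [s' /QE /(_ b'Q) /Qprime/orP[] bQ]].
  by apply/orP; left; apply/Q'E; exists b => //; exists s.
by apply/orP; right; apply/Q'E; exists d => //; exists t.
Qed.

(* If b d = 0 with d <> 0, then b + d has the same image as b in R_S, and
   Ann (Ann (b + d)) is strictly larger than Ann (Ann b). *)
Lemma regular_lift a : noetherian R -> reduced_ring R -> regular (to_loc S a) ->
  exists2 b, to_loc S b = to_loc S a & regular b.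
Proof.
move=> noeth red areg.
pose AA b : set R := [set x | forall y, b * y = 0 -> x * y = 0].
have [||_ [b bE <-] bmax] := @noetherian_max R
    [set A | exists2 b, to_loc S b = to_loc S a & AA b = A] (AA a) noeth.
- by exists a.
- move=> _ [b _ <-]; split=> [y|r x z /= xA zA y yb]; first by rewrite mul0r.
  by rewrite [_ *: _]/(r * x) mulrDl -mulrA xA // zA // mulr0 addr0.
exists b => // d bd; apply/red.
have d0 : to_loc S d = 0 by apply: areg; rewrite -bE -rmorphM bd rmorph0.
(* Maximality puts b + d in the double annihilator of b; tested on d, which b kills, this gives d^2
   = 0. *)
suff /(_ d bd) : AA b (b + d) by rewrite mulrDl bd add0r.
apply: (bmax (AA (b + d))) => [|x xA y bdy|//].
  by exists (b + d) => //; rewrite rmorphD /= d0 addr0.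
(* The square of b y equals - (b y)(d y), which vanishes with b d, so b y = 0. *)
apply: xA; have h : b * y = - (d * y).
  by apply/eqP; rewrite -addr_eq0 -mulrDl bdy.
have bby : (b * y) * (b * y) = 0.
  by rewrite [X in _ * X]h mulrN mulrACA bd mul0r oppr0.
exact: red.
Qed.

(** The numerator of k is k times a unit, hence regular in R_S, and has the same image as some
    regular b. Passing to a multiple of k is harmless, since it preserves the vanishing of
    tensors. *)
Lemma Rcirc_lift k : noetherian R -> reduced_ring R -> Rcirc k ->
  exists2 b, Rcirc b & exists l, to_loc S b = l * k.
Proof.
move=> noeth red; have [a [s ->]] := mklocP k => kR.
have kreg := Rcirc_regular (reduced_loc red) kR.
have [|b bE breg] := @regular_lift a noeth red.
  move=> d; rewrite -(mkloc_den a s) -mulrA => sad; apply: kreg.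
  rewrite -[LHS]mul1r; have <- : mkloc 1 s * to_loc S (val s) = 1.
    by rewrite mkloc_mul; apply: mkloc_eqW => /=; ring.
  by rewrite -mulrA sad mulr0.
exists b; first exact: regular_Rcirc.
by exists (to_loc S (val s)); rewrite mkloc_den.
Qed.

End LocalizationTheory.

(** * Existence of injective hulls *)

Section AdditiveExtension.
Variables (p : nat) (R : comPzRingType) (pR : p \in pzchar R).

Lemma pzchar_prime : prime p. Proof. by case/andP: pR. Qed.

Lemma mulrn_pzchar (M : lmodType R) (x : M) n : x *+ (n * p) = 0.
Proof.
rewrite mulrnA -[_ *+ p]scale1r -scalerMnr scalerMnl; case/andP: pR => _ /eqP->.
by rewrite scale0r.
Qed.

(* In characteristic p, modules are F_p-vector spaces and additive maps are
   F_p-linear; the maximal partial extension is found through its graph. *)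
Lemma additive_ext (A B K : lmodType R) (f : {additive A -> B})
    (g : {additive A -> K}) : injective f ->
  exists h : {additive B -> K}, forall x, h (f x) = g x.
Proof.
move=> finj.
pose good (G : set (B * K)) :=
  [/\ G 0, forall u v, G u -> G v -> G (u - v) & forall v, G (0, v) -> v = 0].
have [||G [fG [G0 GB Gfun] Gmax]] := @zorn_above _ good (range (fun x => (f x, g x))).
- split; first by exists 0 => //; rewrite !raddf0.
    by move=> _ _ [x _ <-] [y _ <-]; exists (x - y) => //; rewrite !raddfB.
  move=> v [x _ [fx <-]]; suff -> : x = 0 by rewrite raddf0.
  by apply: finj; rewrite fx raddf0.
- move=> F FA Fgood Ftot; split.
  + by exists (range (fun x => (f x, g x))) => //; have [] := Fgood _ FA.
  + move=> u v Fu Fv; have [X [FX Xu Xv]] := chain2 Ftot Fu Fv.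
    by exists X => //; have [_ XB _] := Fgood _ FX; apply: XB.
  + by move=> v [X FX Xv]; have [_ _] := Fgood _ FX; apply.
have GN u : G u -> G (- u) by move=> Gu; rewrite -sub0r; apply: GB.
have GD u v : G u -> G v -> G (u + v).
  by move=> Gu Gv; rewrite -[v]opprK; apply: GB => //; apply: GN.
have GMn u n : G u -> G (u *+ n).
  by move=> Gu; elim: n => [|n IH]; rewrite ?mulr0n // mulrS; apply: GD.
have Gtot b : exists v, G (b, v).
  apply: contrapT => nb.
  (* [G'] extends the partial map by the value 0 at b. *)
  pose G' := [set u : B * K | exists2 w, G w & exists n, u = w + (b *+ n, 0)].
  have GG' : G `<=` G'.
    by move=> u Gu; exists u => //; exists 0%N; rewrite mulr0n addr0.
  have bG' : G' (b, 0) by exists 0 => //; exists 1%N; rewrite mulr1n add0r.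
  apply: (nb); exists 0; apply: (Gmax _ GG') => //; split; first exact: GG'.
    move=> _ _ [w Gw [k ->]] [w' Gw' [n ->]]; exists (w - w'); first exact: GB.
    (* The multiple n (p - 1) serves as - n, because p kills b. *)
    exists (k + n * p.-1)%N; rewrite opprD addrACA; congr (_ + _).
    apply/eqP; rewrite xpair_eqE /= subrr eqxx andbT mulrnDr; apply/eqP; congr (_ + _).
    apply/eqP; rewrite eq_sym -addr_eq0 -mulrnDr -mulnSr prednK ?mulrn_pzchar //.
    exact/prime_gt0/pzchar_prime.
  move=> v [[x v'] Gw [n [/eqP]]]; rewrite eq_sym addr_eq0 addr0 => /eqP xE vE.
  (* Here [G] contains (- n b, v'). If p divides n then n b = 0; otherwise an inverse of n modulo p
     puts b in the domain of [G], contrary to its choice. *)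
  rewrite vE; apply: Gfun; have [/dvdnP[k nE]|pn] := boolP (p %| n)%N.
    by move: Gw; rewrite xE nE mulrn_pzchar oppr0.
  exfalso; apply: nb.
  have n_gt0 : (0 < n)%N by case: n pn {xE} => //; rewrite dvdn0.
  have [u k E _] := egcdnP p n_gt0.
  exists (- (v' *+ u)); have := GN _ (GMn _ u Gw); congr G.
  have cop : gcdn n p = 1%N.
    by apply/eqP; rewrite -/(coprime n p) coprime_sym prime_coprime ?pzchar_prime.
  have -> : - ((x, v') *+ u) = (- (x *+ u), - (v' *+ u)).
    by apply/eqP; elim: (u) => [|u' IH]; rewrite ?mulr0n ?oppr0 // !mulrS !opprD (eqP IH).
  congr (_, _); rewrite xE mulNrn opprK -mulrnA mulnC E cop mulrnDr.
  by rewrite mulrn_pzchar add0r.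
have Guniq b v w : G (b, v) -> G (b, w) -> v = w.
  move=> Gv Gw; apply/eqP; rewrite -subr_eq0; apply/eqP/Gfun.
  by have := GB _ _ Gv Gw; congr G; rewrite -[LHS]/(b - b, v - w) subrr.
pose h b := sval (cid (Gtot b)); have hG b : G (b, h b) by rewrite /h; case: cid.
have hB : zmod_morphism h.
  by move=> b c; apply: (@Guniq (b - c)) => //; apply: (GB (b, h b) (c, h c)).
exists (addmap_of hB) => x; apply: (@Guniq (f x)) => //; apply: fG.
by exists x.
Qed.

End AdditiveExtension.

Section Coinduced.
Variables (R : comPzRingType) (K : lmodType R).

(* Hom_Z(R, K) with R acting on the argument. *)
Record coind := Coind { coind_fun :> R -> K; coindP : zmod_morphism coind_fun }.

Lemma coind_eq (f g : coind) : f =1 g -> f = g.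
Proof.
case: f g => f fP [g gP] /= /funext fg; move: fP; rewrite fg => fP.
by congr Coind; apply: Prop_irrelevance.
Qed.

HB.instance Definition _ := gen_eqMixin coind.
HB.instance Definition _ := gen_choiceMixin coind.

Lemma coind0P : zmod_morphism (fun _ : R => 0 : K).
Proof. by move=> r s; rewrite subr0. Qed.
Lemma coindNP (f : coind) : zmod_morphism (fun r => - f r).
Proof. by move=> r s; rewrite coindP opprD. Qed.
Lemma coindDP (f g : coind) : zmod_morphism (fun r => f r + g r).
Proof. by move=> r s; rewrite !coindP opprD addrACA. Qed.
Lemma coindZP a (f : coind) : zmod_morphism (fun r => f (a * r)).
Proof. by move=> r s; rewrite mulrBr coindP. Qed.

Definition coind_zero := Coind coind0P.
Definition coind_opp f := Coind (coindNP f).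
Definition coind_add f g := Coind (coindDP f g).
Definition coind_scale a f := Coind (coindZP a f).

Lemma coind_addA : associative coind_add.
Proof. by move=> f g h; apply: coind_eq => r /=; rewrite addrA. Qed.
Lemma coind_addC : commutative coind_add.
Proof. by move=> f g; apply: coind_eq => r /=; rewrite addrC. Qed.
Lemma coind_add0 : left_id coind_zero coind_add.
Proof. by move=> f; apply: coind_eq => r /=; rewrite add0r. Qed.
Lemma coind_addN : left_inverse coind_zero coind_opp coind_add.
Proof. by move=> f; apply: coind_eq => r /=; rewrite addNr. Qed.

HB.instance Definition _ := GRing.isZmodule.Build coind
  coind_addA coind_addC coind_add0 coind_addN.

Lemma coindD (f : coind) r s : f (r + s) = f r + f s.
Proof.
have f0 : f 0 = 0 by have := coindP f 0 0; rewrite !subrr.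
by rewrite -[s in LHS]opprK -[- s]sub0r !coindP f0 sub0r opprK.
Qed.

Lemma coind_scaleA a b f : coind_scale a (coind_scale b f) = coind_scale (a * b) f.
Proof. by apply: coind_eq => r /=; rewrite mulrCA mulrA. Qed.
Lemma coind_scale1 : left_id 1 coind_scale.
Proof. by move=> f; apply: coind_eq => r /=; rewrite mul1r. Qed.
Lemma coind_scaleDr : right_distributive coind_scale +%R.
Proof. by move=> a f g; apply: coind_eq. Qed.
Lemma coind_scaleDl f : {morph coind_scale^~ f : a b / a + b}.
Proof. by move=> a b; apply: coind_eq => r /=; rewrite mulrDl coindD. Qed.

HB.instance Definition _ := GRing.Zmodule_isLmodule.Build R coind
  coind_scaleA coind_scale1 coind_scaleDr coind_scaleDl.

(** By adjunction, linear maps A -> Hom_Z(R, K) are additive maps A -> K, through evaluation at 1;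
    the latter extend by [additive_ext]. *)
Lemma coind_injective p : p \in pzchar R -> injective_module coind.
Proof.
move=> pR A B f g finj; pose g1 (x : A) : K := g x 1.
have g1B : zmod_morphism g1 by move=> x y; rewrite /g1 raddfB.
have [h1 h1E] := additive_ext pR (addmap_of g1B) finj.
have hP b : zmod_morphism (fun r : R => h1 (r *: b)).
  by move=> r s; rewrite scalerBl raddfB.
have hlin : linear (fun b => Coind (hP b)).
  move=> a b c; apply: coind_eq => r.
  by rewrite /= scalerDr raddfD scalerA mulrC.
exists (mklin hlin) => x; apply: coind_eq => r /=.
by rewrite -linearZ h1E /= /g1 linearZ /= mulr1.
Qed.

Lemma to_coindP (x : K) : zmod_morphism (fun r : R => r *: x).
Proof. by move=> r s; rewrite scalerBl. Qed.

Lemma to_coind_linear : linear (fun x => Coind (to_coindP x)).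
Proof.
move=> a x y; apply: coind_eq => r /=.
by rewrite scalerDr scalerA mulrC.
Qed.

Definition to_coind : {linear K -> coind} := mklin to_coind_linear.

Lemma to_coind_inj : injective to_coind.
Proof.
by move=> x y /(congr1 (fun f : coind => f 1)) /=; rewrite !scale1r.
Qed.

End Coinduced.

(* Take E maximal among the submodules of D essential over K, and C maximal
   with C ∩ E = 0.  The inclusion of E extends to sigma : D/C -> D, which is
   injective by maximality of C; its image is essential over K, hence is E by
   maximality of E, so that sigma splits D -> D/C. *)
Lemma injective_hull_sub (R : comPzRingType) (K D : lmodType R)
    (j : {linear K -> D}) : injective_module D -> injective j ->
  exists (E : lmodType R) (i : {linear K -> E}), injective_hull i.
Proof.
move=> Dinj jinj.
pose ess (E : set D) := is_submod E /\
  forall x, E x -> x <> 0 -> exists a y, a *: x = j y /\ j y <> 0.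
have [||E1 [jE [Esub Eess] Emax]] := @zorn_above _ ess (range j).
- split=> [|_ [y _ <-] jy0]; last by exists 1, y; rewrite scale1r.
  split; first by exists 0 => //; rewrite linear0.
  by move=> a _ _ [x _ <-] [y _ <-]; exists (a *: x + y) => //; rewrite linearP.
- move=> F FA Fess Ftot; split; last by move=> x [X FX]; have [_] := Fess _ FX; apply.
  by apply: (submod_bigcup FA) => // N /Fess[].
pose disj (C : set D) := is_submod C /\ forall x, C x -> E1 x -> x = 0.
have [||C1 [_ [Csub CE] Cmax]] := @zorn_above _ disj [set 0].
- by split=> // ; split=> // a x y /= -> ->; rewrite scaler0 addr0.
- move=> F FA Fdisj Ftot; split; last by move=> x [X FX]; have [_] := Fdisj _ FX; apply.
  by apply: (submod_bigcup FA) => // N /Fdisj[].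
pose Es := submod_of Esub; pose C := submod_of Csub.
have CP x : x \in C <-> C1 x by exact: (in_submod_of Csub x).
have EP x : x \in Es <-> E1 x by exact: (in_submod_of Esub x).
have [sigma sE] : exists s : {linear quotM C -> D}, forall x, E1 x -> s (modcls C x) = x.
  have [|h hE] := @inj_ext R _ _ _ (quot_map C \o submod_val Es) (submod_val Es) Dinj.
    by move=> x /modcls0/CP Cx; apply: CE => //; apply/EP; apply: (valP x).
  by exists h => x /EP xE; apply: (hE (exist _ x xE)).
(* By maximality of C, adjoining an element outside it creates a nonzero intersection with E. *)
have Cadj d : ~ C1 d -> exists c a, [/\ C1 c, E1 (c + a *: d) & c + a *: d <> 0].
  move=> nCd; apply: contrapT => h; apply: nCd.
  pose C' := [set x | exists2 c, C1 c & exists a, x = c + a *: d].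
  apply: (Cmax C').
  - by move=> c Cc; exists c => //; exists 0; rewrite scale0r addr0.
  - split; last first.
      move=> _ [c Cc [a ->]] Ex; apply: contrapT => x0; apply: h.
      by exists c, a.
    split; first by exists 0; [exact: (proj1 Csub)|exists 0; rewrite scale0r addr0].
    move=> r _ _ [c Cc [a ->]] [c' Cc' [a' ->]].
    exists (r *: c + c'); first exact: (proj2 Csub).
    by exists (r * a + a'); rewrite scalerDr addrACA scalerA scalerDl.
  - by exists 0; [exact: (proj1 Csub)|exists 1; rewrite scale1r add0r].
have modC c : C1 c -> modcls C c = 0 by move=> /CP/modcls0.
have sC d c a : C1 c -> E1 (c + a *: d) -> a *: sigma (modcls C d) = c + a *: d.
  move=> Cc Ed; rewrite -linearZ -[_ *: _]/(quotM_scale _ _) quotM_scaleE.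
  by rewrite -[RHS]sE // modclsD (modC c Cc) add0r.
have sinj z : sigma z = 0 -> z = 0.
  have [d ->] := modclsP z; move=> sd; apply/modcls0/CP.
  apply: contrapT => /Cadj[c [a [Cc Ed]]].
  by rewrite -(sC d) // sd scaler0.
have sim z : E1 (sigma z).
  apply: (Emax (range sigma)); last by exists z.
    by move=> x Ex; exists (modcls C x) => //; apply: sE.
  split; first (split; first by exists 0 => //; rewrite linear0).
    by move=> a _ _ [x _ <-] [y _ <-]; exists (a *: x + y) => //; rewrite linearP.
  move=> _ [w _ <-]; have [d ->] := modclsP w => sd.
  have [|c [a [Cc Ed ed0]]] := Cadj d.
    by move=> /modC d0; apply: sd; rewrite d0 linear0.
  have [b [y [by0 jy]]] := Eess _ Ed ed0.
  by exists (b * a), y; rewrite -scalerA (sC d c).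
(* The values of [sigma] lie in E, which [sigma] fixes, and injectivity cancels [sigma]. So D / C is
   a retract of D and inherits its injectivity. *)
have sK z : modcls C (sigma z) = z.
  apply/eqP; rewrite -subr_eq0; apply/eqP/sinj.
  by rewrite linearB sE // subrr.
pose i : {linear K -> quotM C} := quot_map C \o j.
have iinj : injective i.
  apply: lin_inj => y /modcls0/CP Cy; apply: jinj; rewrite linear0; apply: CE => //.
  by apply: jE; exists y.
exists (quotM C), i; split; last (split=> // N [z zN /eqP z0]).
  move=> A B f g finj; have [h hE] := Dinj _ _ f (sigma \o g) finj.
  by exists (quot_map C \o h) => x; rewrite /= hE /= sK.
have [|a [y [ay jy0]]] := Eess _ (sim z); first by move/sinj.
have iy : i y = a *: z by rewrite /i /= -ay -linearZ /= sK.
exists y; first by rewrite iy rpredZ.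
apply/eqP => iy0; apply: jy0; suff -> : y = 0 by rewrite linear0.
by apply: iinj; rewrite iy0 linear0.
Qed.

Lemma injective_hull_exists p (R : comPzRingType) (K : lmodType R) :
  p \in pzchar R -> exists (E : lmodType R) (i : {linear K -> E}), injective_hull i.
Proof.
move=> pR; apply: (injective_hull_sub (D := coind K)) (@to_coind_inj R K).
exact: coind_injective pR.
Qed.

(** * Tensors and linear maps over R and over R_S *)

Section BaseChange.
Variables (p : nat) (R : comPzRingType) (pR : p \in pzchar R) (S : mulrClosed R).
Variables (Y : lmodType (loc S)) (E : lmodType R) (e : nat).
Local Notation pS := (pzchar_loc S pR).

(** The map x ⊗ c ↦ theta x ⊗ c/1 is well defined because Frobenius commutes with R -> R_S. *)
Lemma tens_to_loc (theta : {additive E -> Y}) x (c : R) :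
  (forall a y, theta (a *: y) = to_loc S a *: theta y) ->
  tens x (c : frob pR e) = 0 -> tens (theta x) (to_loc S c : frob pS e) = 0.
Proof.
move=> thetaZ.
have [||| G GE] := @tensor_lift R E (frob pR e) (tensor Y (frob pS e))
  (fun x c => tens (theta x) (to_loc S c : frob pS e)).
- by move=> *; rewrite raddfD tensDl.
- by move=> x0 y y'; rewrite rmorphD; apply: tensDr.
- move=> a y d; rewrite thetaZ tensZ; congr (tens _ _).
  by rewrite !frob_scaleE rmorphM rmorphXn.
by rewrite -GE => ->; rewrite raddf0.
Qed.

Variable theta : {additive Y -> E}.
Hypothesis thetaZ : forall a y, theta (to_loc S a *: y) = a *: theta y.

Let n := (p ^ e).-1.
Let qE : (p ^ e)%N = n.+1.
Proof. by rewrite prednK // expn_gt0 prime_gt0 // (pzchar_prime pR). Qed.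

(* The image of y ⊗ (r/t) under the isomorphism
   Y ⊗ R_S^(-e) = Y ⊗ R^(-e): with q = p^e, r/t = r t^(q-1) / t^q. *)
Let G0 (y : Y) (r : R) (t : {s : R | s \in S}) : tensor E (frob pR e) :=
  tens (theta (mkloc 1 t *: y)) (r * val t ^+ n : frob pR e).

(** Expansion of the denominator by w: 1/t = w / (w t), and w crosses the tensor sign as w^(p^e). *)
Let G0_scale y r t w : G0 y r t =
  tens (theta (mkloc 1 (denM w t) *: y))
       ((val w ^+ (p ^ e)) * (r * val t ^+ n) : frob pR e).
Proof.
rewrite /G0; have -> : mkloc 1 t = to_loc S (val w) * mkloc 1 (denM w t).
  by rewrite mkloc_mul; apply: mkloc_eqW => /=; ring.
by rewrite -scalerA thetaZ tensZ.
Qed.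

(** Both sides are expanded to the common denominator u t t', where u witnesses the equality of the
    two fractions. *)
Let G0_eq y r t r' t' : mkloc r t = mkloc r' t' -> G0 y r t = G0 y r' t'.
Proof.
case/mkloc_eq => u uS; rewrite mulrBr => /eqP; rewrite subr_eq0 => /eqP h.
pose U := exist (fun s => s \in S) u uS.
rewrite (G0_scale y r t (denM U t')) (G0_scale y r' t' (denM U t)).
have -> : mkloc 1 (denM (denM U t') t) = mkloc 1 (denM (denM U t) t').
  by apply: mkloc_eqW => /=; ring.
congr (tens _ _); rewrite qE [val (denM U t')]/= [val (denM U t)]/=.
rewrite !exprS !exprMn; move: h; move: (u ^+ n) (val t ^+ n) (val t' ^+ n).
move=> A B C h.
have key (v a b x x' : R) : v * (x * b) = v * (x' * a) ->
    v * b * (A * C) * (x * B) = v * a * (A * B) * (x' * C).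
  by move=> hv; transitivity (A * B * C * (v * (x * b))); [|rewrite hv]; ring.
exact: key h.
Qed.

Lemma tens_of_loc y (c : R) :
  tens y (to_loc S c : frob pS e) = 0 -> tens (theta y) (c : frob pR e) = 0.
Proof.
pose g (y : Y) (k : frob pS e) := G0 y (loc_num k) (loc_den k).
have gE x r t : g x (mkloc r t) = G0 x r t by apply: G0_eq; apply: loc_numden.
have gZ a x k : g (to_loc S a *: x) k = g x (to_loc S a ^+ (p ^ e) * k).
  have [r [t ->]] := mklocP k; rewrite -rmorphXn.
  have -> : to_loc S (a ^+ (p ^ e)) * mkloc r t = mkloc (a ^+ (p ^ e) * r) t.
    by rewrite mkloc_mul; apply: mkloc_eqW => /=; ring.
  rewrite !gE /G0 scalerA mulrC -scalerA thetaZ tensZ; congr (tens _ _).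
  by rewrite frob_scaleE mulrA.
have [||| G GE] := @tensor_lift (loc S) Y (frob pS e) _ g.
- by move=> x x' k; rewrite /g /G0 scalerDr raddfD tensDl.
- move=> x k l; have [r [t ->]] := mklocP k; have [s [u ->]] := mklocP l.
  rewrite [X in g _ X](mkloc_add r t s u) !gE (G0_scale x r t u) (G0_scale x s u t).
  rewrite /G0; have -> : mkloc 1 (denM u t) = mkloc 1 (denM t u).
    by apply: mkloc_eqW => /=; ring.
  rewrite -tensDr; congr (tens _ _); rewrite [val (denM t u)]/= qE !exprS exprMn.
  by ring.
- move=> k x l; rewrite frob_scaleE; have [a [s ->]] := mklocP k.
  (* Writing x as s (x/s) cancels the denominator of k, which reduces balancedness over R_S to
     [gZ]. *)
  have xE : x = to_loc S (val s) *: (mkloc 1 s *: x).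
    by rewrite scalerA mkloc_den rmorph1 scale1r.
  rewrite [x in RHS]xE gZ mulrA -exprMn mkloc_den -gZ scalerA.
  by rewrite [in RHS]mulrC -mkloc_frac.
have : G (tens y (to_loc S c : frob pS e)) = tens (theta y) (c : frob pR e).
  by rewrite GE gE /G0 [val _]/= expr1n mulr1 scale1r.
by move=> <- ->; rewrite raddf0.
Qed.

End BaseChange.

(** Denominators act invertibly on both modules, so compatibility with numerators is enough. *)
Lemma loc_linear (R : comPzRingType) (S : mulrClosed R) (Y Z : lmodType (loc S))
    (f : Y -> Z) : zmod_morphism f ->
  (forall a y, f (to_loc S a *: y) = to_loc S a *: f y) -> linear f.
Proof.
move=> fB fZ k x y; rewrite [LHS](raddfD (addmap_of fB)); congr (_ + _).
have [a [s ->]] := mklocP k.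
have sK (z : Z) : mkloc 1 s *: (to_loc S (val s) *: z) = z.
  rewrite scalerA; have -> : mkloc 1 s * to_loc S (val s) = 1.
    by rewrite mkloc_mul; apply: mkloc_eqW => /=; ring.
  exact: scale1r.
rewrite -[LHS]sK -[RHS]sK; congr (_ *: _).
by rewrite -[LHS]fZ !scalerA mkloc_den [LHS]fZ.
Qed.

(** * Modules over R_S as modules over R, and conversely *)

Section Restriction.
Variables (R : comPzRingType) (S : mulrClosed R) (Y : lmodType (loc S)).

Definition restr : Type := Y.
HB.instance Definition _ := GRing.Zmodule.on restr.

Definition restr_scale (a : R) (y : restr) : restr := to_loc S a *: (y : Y).

Lemma restr_scaleA a b y : restr_scale a (restr_scale b y) = restr_scale (a * b) y.
Proof. by rewrite /restr_scale scalerA rmorphM. Qed.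
Lemma restr_scale1 : left_id 1 restr_scale.
Proof. by move=> y; rewrite /restr_scale rmorph1 scale1r. Qed.
Lemma restr_scaleDr : right_distributive restr_scale +%R.
Proof. by move=> a y z; rewrite /restr_scale scalerDr. Qed.
Lemma restr_scaleDl y : {morph restr_scale^~ y : a b / a + b}.
Proof. by move=> a b; rewrite /restr_scale rmorphD scalerDl. Qed.

HB.instance Definition _ := GRing.Zmodule_isLmodule.Build R restr
  restr_scaleA restr_scale1 restr_scaleDr restr_scaleDl.

End Restriction.

Section LocalModule.
Variables (R : comPzRingType) (S : mulrClosed R) (E : lmodType R).

Definition S_bijective : Prop := forall s, s \in S ->
  injective (fun x : E => s *: x) /\ forall x : E, exists y, s *: y = x.

Hypothesis SE : S_bijective.

(** The proof is a parameter of the type so that the R_S-structure, which divides by elements of S,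
    can be attached to it. *)
Definition locmod of S_bijective : Type := E.
Local Notation ES := (locmod SE).
HB.instance Definition _ := GRing.Zmodule.on ES.

Definition divS (s : {s : R | s \in S}) (x : E) : E :=
  sval (cid ((SE (valP s)).2 x)).

Lemma divSK s x : val s *: divS s x = x.
Proof. by rewrite /divS; case: cid. Qed.

Definition locmod_scale (k : loc S) (x : ES) : ES :=
  loc_num k *: divS (loc_den k) x.

Lemma locmod_scaleE a s (x : ES) :
  val s *: (locmod_scale (mkloc a s) x : E) = a *: (x : E).
Proof.
have /mkloc_eq[u uS] := loc_numden (mkloc a s); rewrite /locmod_scale.
move: (loc_num _) (loc_den _) => b t; rewrite mulrBr => /eqP.
rewrite subr_eq0 => /eqP h; apply: (SE uS).1; rewrite /= -[in RHS](divSK t x) !scalerA.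
by congr (_ *: _); rewrite /= in h *; apply: etrans (etrans _ h) _; ring.
Qed.

Lemma locmod_scaleU a s (x y : ES) :
  val s *: (y : E) = a *: (x : E) -> locmod_scale (mkloc a s) x = y.
Proof.
move=> h; apply: (SE (valP s)).1.
exact: etrans (locmod_scaleE _ _ _) (esym h).
Qed.

Lemma locmod_scaleA j k x :
  locmod_scale j (locmod_scale k x) = locmod_scale (j * k) x.
Proof.
have [a [s ->]] := mklocP j; have [b [t ->]] := mklocP k.
rewrite mkloc_mul; apply/esym/locmod_scaleU.
rewrite -[val (denM s t)]/(val s * val t) mulrC -!scalerA locmod_scaleE.
by rewrite [LHS]scalerA (mulrC (val t)) -[LHS]scalerA locmod_scaleE.
Qed.

Lemma locmod_scale1 : left_id 1 locmod_scale.
Proof. by move=> x; apply: (@locmod_scaleU 1 (den1 S)). Qed.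

Lemma locmod_scaleDr : right_distributive locmod_scale +%R.
Proof.
move=> k x y; have [a [s ->]] := mklocP k; apply: locmod_scaleU.
by rewrite (scalerDr (val s)) !locmod_scaleE -scalerDr.
Qed.

Lemma locmod_scaleDl x : {morph locmod_scale^~ x : j k / j + k}.
Proof.
move=> j k; have [a [s ->]] := mklocP j; have [b [t ->]] := mklocP k.
rewrite mkloc_add; apply: locmod_scaleU.
rewrite -[val (denM s t)]/(val s * val t) (scalerDr (val s * val t)) scalerDl.
rewrite [in X in X + _ = _](mulrC (val s)) -!scalerA !locmod_scaleE !scalerA.
by rewrite (mulrC (val t)) (mulrC (val s)).
Qed.

HB.instance Definition _ := GRing.Zmodule_isLmodule.Build (loc S) ES
  locmod_scaleA locmod_scale1 locmod_scaleDr locmod_scaleDl.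

Lemma to_locmod_scale a (x : ES) : to_loc S a *: x = (a *: (x : E) : ES).
Proof. by apply: (@locmod_scaleU a (den1 S)); rewrite /= scale1r. Qed.

(** An extension problem over R_S is solved over R after restriction of scalars, and [loc_linear]
    makes the solution R_S-linear. *)
Lemma locmod_injective : injective_module E -> injective_module ES.
Proof.
move=> Einj A B f g finj.
have flin : linear (f : restr A -> restr B).
  move=> a x y; rewrite linearD; congr (_ + _).
  exact: (linearZ_LR f (to_loc S a) (x : A)).
have glin : linear (g : restr A -> E).
  move=> a x y; rewrite linearD; congr (_ + _).
  exact: etrans (linearZ_LR g (to_loc S a) (x : A)) (to_locmod_scale a (g x)).
have [h hE] := Einj _ _ (mklin flin) (mklin glin) finj.
have hlin : linear (h : B -> ES).
  apply: loc_linear => [x y|a y]; first by rewrite linearB.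
  by rewrite to_locmod_scale -linearZ.
by exists (mklin hlin) => x; apply: hE.
Qed.

End LocalModule.

(** * The injective hull of R/m and its socle generator *)

Section HullOfResidueField.
Variables (R : comPzRingType) (m : maxIdeal R) (E : lmodType R).
Variables (i : {linear quotM m -> E}) (hull : injective_hull i).

Lemma socle_neq0 : i (modcls m (1 : R^o)) <> 0.
Proof.
case: hull => _ [iinj _]; rewrite -(linear0 i) => /iinj/modcls0 m1.
by have := maxP1 m; rewrite m1.
Qed.

(** Elements outside m act injectively on R/m, hence on E by essentiality. Extending the identity of
    E along multiplication by s gives h with s h(x) = h(s x) = x. *)
Lemma hull_bijective : S_bijective (compl m) E.
Proof.
case: hull => Einj [iinj iess] s sm; pose S := exist (fun s => s \in compl m) s sm.
have slin : linear (fun x : E => s *: x).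
  by move=> a x y; rewrite scalerDr !scalerA mulrC.
have sinj : injective (mklin slin).
  apply: lin_inj => x sx; apply: contrapT => /eqP x0.
  have [|y /in_submod_of siy iy0] := iess (submod_of (ker_submod (mklin slin))).
    by exists x => //; apply/in_submod_of.
  move/eqP: iy0; apply; suff -> : y = 0 by rewrite linear0.
  apply: (@compl_inj _ _ S); rewrite scaler0; apply: iinj.
  by rewrite linear0 linearZ; exact: siy.
split=> [//|x]; have idlin : linear (idfun : E -> E) by [].
have [h hE] := Einj _ _ (mklin slin) (mklin idlin) sinj.
by exists (h x); rewrite -linearZ; apply: hE.
Qed.

Local Notation Em := (locmod hull_bijective).

Lemma to_loc_residue a (x : residue m) :
  to_loc (compl m) a *: x = a *: (x : quotM m) :> quotM m.
Proof. by have := residue_scaleE a (den1 (compl m)) x; rewrite scale1r. Qed.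

Lemma residue_hull_linear : linear (i : residue m -> Em).
Proof.
apply: loc_linear => [x y|a x]; first exact: linearB.
by rewrite to_loc_residue to_locmod_scale; apply: linearZ_LR.
Qed.

(** As Ann x lies in m, sending a x to a times the socle generator is well defined on R x, and it
    extends by injectivity of E. *)
Lemma map_to_hull (M : lmodType R) (x : M) :
  (forall a, a *: x = 0 -> a \in max_ideal m) ->
  exists h : {linear M -> E}, h x = i (modcls m (1 : R^o)).
Proof.
case: hull => Einj _ xm.
have scl (N : lmodType R) (z : N) : linear (fun a : R^o => (a : R) *: z).
  by move=> a b c; rewrite scalerDl -scalerA.
have [a /xm am|h hE] := inj_ext (f := mklin (scl _ x))
    (g := mklin (scl _ (i (modcls m (1 : R^o))))) Einj.
  rewrite /= -linearZ -[_ *: _]/(quotM_scale _ _) quotM_scaleE.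
  have -> : modcls m (a *: (1 : R^o)) = 0; last by rewrite linear0.
  by apply/modcls0; rewrite [_ *: _]mulr1.
by exists h; have := hE 1; rewrite /= !scale1r.
Qed.

End HullOfResidueField.

(** If k kills a nonzero element it is not a unit of R_m, so its numerator lies in m and kills
    R/m. *)
Lemma residue_ann (R : comPzRingType) (m : maxIdeal R) (W : lmodType (locm m))
    (w : W) (k : locm m) : w <> 0 -> k *: w = 0 ->
  k *: (modcls m (1 : R^o) : residue m) = 0.
Proof.
move=> w0; have [a [s ->]] := mklocP k => kw.
have am : a \in max_ideal m.
  apply: contrapT => /negP am; apply: w0.
  pose A := exist (fun s => s \in compl m) a am.
  rewrite -[w]scale1r; have <- : mkloc (val s) A * mkloc a s = 1.
    by rewrite mkloc_mul; apply: mkloc_eqW => /=; ring.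
  by rewrite -scalerA kw scaler0.
apply: (@compl_inj _ _ s); rewrite residue_scaleE scaler0.
rewrite -[LHS]/(quotM_scale _ _) quotM_scaleE.
by apply/modcls0; rewrite [_ *: _]mulr1.
Qed.

(** * Descent of tight closure and the implications *)

Section MainImplications.
Variables (p : nat) (R : comPzRingType) (pR : p \in pzchar R).

(** For e at least 1, x crosses the tensor sign as x^(p^e) with p^e at least 2, hence as 0. *)
Lemma tight0_nilp (M : lmodType R) (z : M) (x : R) : x * x = 0 -> tight0 pR (x *: z).
Proof.
move=> xx; exists 1; first exact: Rcirc1.
exists 1%N => // e e1; rewrite tensZ frob_scaleE mulr1.
have p1 := prime_gt1 (pzchar_prime pR).
have : (1 < p ^ e)%N by rewrite -(exp1n e) ltn_exp2r.
case: (p ^ e)%N => [|[|q]] // _.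
by rewrite !exprS mulrA xx mul0r tens0r.
Qed.

Lemma strongly_F_regular_reduced : strongly_F_regular pR -> reduced_ring R.
Proof.
case/strongly_F_regularP => _ h x xx.
by rewrite -[x]mulr1; apply: (h R^o); apply: (tight0_nilp (1 : R^o) xx).
Qed.

Lemma tight0_to_loc (S : mulrClosed R) (E : lmodType R) (Y : lmodType (loc S))
    (theta : {additive E -> Y}) x :
  (forall a y, theta (a *: y) = to_loc S a *: theta y) ->
  tight0 pR x -> tight0 (pzchar_loc S pR) (theta x).
Proof.
move=> thetaZ [c cR [e0 e01 xc]]; exists (to_loc S c); first exact: Rcirc_loc.
by exists e0 => // e /xc; apply: tens_to_loc.
Qed.

(** The multiplier in (R_S)° is first replaced by a multiple coming from R°, after which
    [tens_of_loc] applies. *)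
Lemma tight0_of_loc (S : mulrClosed R) (E : lmodType R) (Y : lmodType (loc S))
    (theta : {additive Y -> E}) y :
  noetherian R -> reduced_ring R ->
  (forall a y, theta (to_loc S a *: y) = a *: theta y) ->
  tight0 (pzchar_loc S pR) y -> tight0 pR (theta y).
Proof.
move=> noeth red thetaZ [k kR [e0 e01 yk]].
have [c cR [l cl]] := Rcirc_lift noeth red kR.
exists c => //; exists e0 => // e /yk /(tens_frob_mul l) ylk.
by apply: (tens_of_loc thetaZ); rewrite cl.
Qed.

Lemma idfun_additive (U : zmodType) : zmod_morphism (idfun : U -> U).
Proof. by []. Qed.

Lemma strongly_F_regular_loc (S : mulrClosed R) :
  strongly_F_regular pR -> strongly_F_regular (pzchar_loc S pR).
Proof.
move=> sR; have red := strongly_F_regular_reduced sR.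
have [noeth h] := (strongly_F_regularP pR).1 sR.
apply/strongly_F_regularP; split; first exact: noetherian_loc.
move=> Y y ty; apply: (h (restr Y)).
by apply: (@tight0_of_loc S (restr Y) Y (addmap_of (@idfun_additive Y))) ty.
Qed.

Lemma tight0_hull_of_loc (m : maxIdeal R) (E : lmodType R)
    (i : {linear quotM m -> E}) (hull : injective_hull i) :
  (forall x : locmod (hull_bijective hull), tight0 (pzchar_loc (compl m) pR) x -> x = 0) ->
  forall x : E, tight0 pR x -> x = 0.
Proof.
move=> h x tx; apply: h.
apply: (@tight0_to_loc (compl m) E (locmod (hull_bijective hull))
  (addmap_of (@idfun_additive E))) tx.
by move=> a y; rewrite to_locmod_scale.
Qed.

(** A nonzero x of square zero would be sent by some map f : R -> E to the socle generator, yet x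
    f(1) lies in the tight closure of 0. *)
Lemma hull_reduced :
  (forall (m : maxIdeal R) (E : lmodType R) (i : {linear quotM m -> E}),
    injective_hull i -> forall x : E, tight0 pR x -> x = 0) -> reduced_ring R.
Proof.
move=> h x xx; apply: contrapT => x0.
have [m xm] := @maxIdeal_ann R R^o x x0.
have [E [i hull]] := injective_hull_exists (quotM m) pR.
have [f fE] := map_to_hull hull (M := R^o) xm.
apply: (socle_neq0 hull); rewrite -fE.
have -> : f x = x *: f (1 : R^o) by rewrite -linearZ; congr (f _); rewrite [RHS]mulr1.
exact/(h _ _ _ hull)/tight0_nilp.
Qed.

(** The hull E' of R/m over R is injective over R_m, and essentiality makes the map E -> E'
    extending R/m -> E' injective; tight closure is then tested in E' over R. *)
Lemma tight0_locm_hull (m : maxIdeal R) :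
  noetherian R ->
  (forall (m : maxIdeal R) (E : lmodType R) (i : {linear quotM m -> E}),
    injective_hull i -> forall x : E, tight0 pR x -> x = 0) ->
  forall (E : lmodType (locm m)) (i : {linear residue m -> E}),
  injective_hull i ->
  forall x : E, tight0 (pzchar_loc (compl m) pR) x -> x = 0.
Proof.
move=> noeth h E i [Einj [iinj iess]] x tx.
have red := hull_reduced h.
have [E' [i' hull]] := injective_hull_exists (quotM m) pR.
pose E'm := locmod (hull_bijective hull).
have E'inj : injective_module E'm by apply: locmod_injective; exact: hull.1.
have [g gE] := E'inj _ _ i (mklin (residue_hull_linear hull)) iinj.
have ginj : injective g.
  apply: lin_inj => z gz; apply: contrapT => /eqP z0.
  have [|y /in_submod_of giy /eqP iy0] := iess (submod_of (ker_submod g)).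
    by exists z => //; apply/in_submod_of.
  apply: iy0; suff -> : y = 0 by rewrite linear0.
  have [_ [i'inj _]] := hull; apply: i'inj; rewrite linear0.
  exact: etrans (esym (gE y)) giy.
apply: ginj; rewrite linear0; apply: (h _ _ _ hull).
apply: (@tight0_of_loc (compl m) E' E'm (addmap_of (@idfun_additive E')) (g x)) => //.
  by move=> a y; rewrite /= to_locmod_scale.
exact: tight0_lin.
Qed.

Lemma hull_very_strongly_F_regular (m : maxIdeal R) :
  noetherian R ->
  (forall (E : lmodType (locm m)) (i : {linear residue m -> E}),
  injective_hull i ->
  forall x : E, tight0 (pzchar_loc (compl m) pR) x -> x = 0) ->
  very_strongly_F_regular (pzchar_loc (compl m) pR).
Proof.
move=> noeth h; split; first exact: noetherian_loc.
move=> c cR; set pm := pzchar_loc _ _.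
have [E [i hull]] := @injective_hull_exists p (locm m) (residue m) pm.
pose o : residue m := modcls m (1 : R^o).
have io0 : i o <> 0.
  case: hull => _ [iinj _]; rewrite -(linear0 i) => /iinj/modcls0 m1.
  by have := maxP1 m; rewrite m1.
(* Otherwise c would put the socle generator in the tight closure of 0. *)
have [e e0 oc] : exists2 e, (0 < e)%N & tens (i o) (c : frob pm e) <> 0.
  apply: contrapT => H; apply: io0; apply: (h _ _ hull); exists c => //.
  exists 1%N => // e e1; apply: contrapT => oc; apply: H; by exists e.
exists e => //; apply/pure_cF => W w wc; apply: contrapT => w0; apply: oc.
have scl (N : lmodType (locm m)) (z : N) : linear (fun a : (locm m)^o => (a : locm m) *: z).
  by move=> a b d; rewrite scalerDl -scalerA.
have [k kw|f fE] := inj_ext (f := mklin (scl _ w)) (g := mklin (scl _ (i o))) hull.1.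
  by rewrite /= -linearZ (residue_ann w0 kw) linear0.
have <- : f w = i o by have := fE 1; rewrite /= !scale1r.
exact: tens_lin_l.
Qed.

Lemma very_strongly_strongly : noetherian R ->
  (forall m : maxIdeal R, very_strongly_F_regular (pzchar_loc (compl m) pR)) ->
  strongly_F_regular pR.
Proof.
move=> noeth h; apply/strongly_F_regularP; split=> // M x tx.
apply: contrapT => x0; have [m xm] := maxIdeal_ann x0.
have [E [i hull]] := injective_hull_exists (quotM m) pR.
have [f fE] := map_to_hull hull xm.
apply: (socle_neq0 hull); rewrite -fE.
apply: (tight0_hull_of_loc (hull := hull)) (tight0_lin f tx).
move=> y [c cR [e0 e01 yc]]; have [_ /(_ c cR)[e e_gt0 cpure]] := h m.
(* The multiple e0 e of e is at least e0, where y ⊗ c vanishes. *)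
have /pure_cF := pure_cF_mul e01 cpure; apply; apply: yc.
by rewrite leq_pmulr.
Qed.

End MainImplications.

Theorem lemma3p6 (p : nat) (R : comPzRingType) (pR : p \in pzchar R)
    (noethR : noetherian R) :
  [<-> strongly_F_regular pR;
       forall S : mulrClosed R, strongly_F_regular (pzchar_loc S pR);
       forall m : maxIdeal R, strongly_F_regular (pzchar_loc (compl m) pR);
       forall (m : maxIdeal R) (E : lmodType R) (i : {linear quotM m -> E}),
         injective_hull i -> tight_closure pR (zero_sub E) = [set 0];
       forall (m : maxIdeal R) (E : lmodType (locm m))
           (i : {linear residue m -> E}),
         injective_hull i ->
         tight_closure (pzchar_loc (compl m) pR) (zero_sub E) = [set 0];
       forall m : maxIdeal R, very_strongly_F_regular (pzchar_loc (compl m) pR)].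
Proof.
tfae=> [sR S|sRS m|sRm m E i hull|h m E i hull|h m|h].
- exact: strongly_F_regular_loc.
- exact: sRS.
(* By [hull_bijective] the hull over R is itself an R_m-module, so strong F-regularity of R_m
   applies to it directly. *)
- apply/tight_closure0; apply: (tight0_hull_of_loc (hull := hull)).
  by have /strongly_F_regularP[_] := sRm m; apply.
- apply/tight_closure0; apply: tight0_locm_hull hull => //.
  by move=> m' E' i' hull'; apply/tight_closure0/h/hull'.
- apply: hull_very_strongly_F_regular => // E i hull.
  exact/tight_closure0/h/hull.
- exact: very_strongly_strongly.
Qed.
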